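(* Let $\Gamma$ be a quiver whose underlying undirected graph is an extended Dynkin diagram. Then there exists an infinite-dimensional transitive Hilbert representation of $\Gamma$ if and only if $\Gamma$ is not an oriented cyclic quiver.
   Context: A quiver $\Gamma=(V,E,s,r)$ consists of a finite set $V$ of vertices, a finite set $E$ of arrows and maps $s,r:E\to V$ (an arrow $\alpha$ goes from $s(\alpha)$ to $r(\alpha)$); loops and multiple arrows are allowed. The underlying undirected graph is obtained by forgetting the directions of the arrows. The extended Dynkin diagrams are the following undirected graphs: $\widetilde{A_n}$ ($n\ge 0$): the cycle with $n+1$ vertices and $n+1$ edges ($\widetilde{A_0}$ is one vertex with one loop, $\widetilde{A_1}$ is two vertices joined by two edges); $\widetilde{D_n}$ ($n\ge 4$): the tree with vertices $1,\dots,n+1$ obtained from a path $5-6-\cdots-(n+1)$ by attaching leaves $1,2$ to vertex $5$ and leaves $3,4$ to vertex $n+1$ (for $n=4$ the path is the single vertex $5$); $\widetilde{E_6}$: the star-shaped tree with a central vertex and three branches of $2,2,2$ further vertices; $\widetilde{E_7}$: central vertex and three branches of $3,3,1$ further vertices; $\widetilde{E_8}$: central vertex and three branches of $5,2,1$ further vertices. An oriented cyclic quiver is a quiver $C_m$ ($m\ge 1$) with vertices $1,\dots,m$ and arrows $\alpha_1,\dots,\alpha_m$ with $\alpha_i:i\to i+1$ for $1\le i\le m-1$ and $\alpha_m:m\to 1$ ($C_1$ is one vertex with one loop). A Hilbert representation $(H,f)$ of $\Gamma$ is a family $H=(H_v)_{v\in V}$ of complex Hilbert spaces together with a family $f=(f_\alpha)_{\alpha\in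 E}$ of bounded linear operators $f_\alpha:H_{s(\alpha)}\to H_{r(\alpha)}$. $End(H,f)$ is the algebra of all families $T=(T_v)_{v\in V}$ of bounded operators $T_v\in B(H_v)$ with $T_{r(\alpha)}f_\alpha=f_\alpha T_{s(\alpha)}$ for all $\alpha\in E$; $I=(I_{H_v})_{v\in V}$. A non-zero Hilbert representation (some $H_v\neq 0$) is called transitive if $End(H,f)=\mathbb{C}I$. $(H,f)$ is infinite-dimensional if $H_v$ is infinite-dimensional for some $v\in V$. *)

(* Defs.v *)
From HB Require Import structures.
From mathcomp Require Import all_boot all_order all_algebra.
From mathcomp Require Import complex.
From mathcomp Require Import all_classical all_reals all_analysis.

Set Implicit Arguments.
Unset Strict Implicit.
Unset Printing Implicit Defensive.

Import Order.TTheory GRing.Theory Num.Theory.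
Import numFieldNormedType.Exports.

Local Open Scope ring_scope.
Local Open Scope complex_scope.

Record quiver := Quiver {
  qvertex : finType;
  qarrow : finType;
  qsrc : qarrow -> qvertex;
  qtgt : qarrow -> qvertex }.

Definition quiver_iso (G G' : quiver) : Prop :=
  exists (f : qvertex G -> qvertex G') (g : qarrow G -> qarrow G'),
    [/\ bijective f, bijective g,
        forall a, qsrc (g a) = f (qsrc a)
      & forall a, qtgt (g a) = f (qtgt a)].

(* [ordS] is the cyclic successor, so this is the oriented cycle C_(n+1). *)
Definition cyclic_quiver (n : nat) : quiver :=
  @Quiver 'I_n.+1 'I_n.+1 id (@ordS n.+1).

Definition oriented_cyclic (G : quiver) : Prop :=
  exists n, quiver_iso G (cyclic_quiver n).

(* Undirected multigraphs: the set of end points of an edge has two elements,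
   or a single one when the edge is a loop. *)
Record ugraph := UGraph {
  uvertex : finType;
  uedge : finType;
  uends : uedge -> {set uvertex};
  uends_card : forall e, (0 < #|uends e| <= 2)%N }.

Lemma card_pair_ends (T : finType) (x y : T) : (0 < #|[set x; y]%SET| <= 2)%N.
Proof. by rewrite cards2; case: (x != y). Qed.

Definition underlying (G : quiver) : ugraph :=
  @UGraph (qvertex G) (qarrow G) (fun a => [set qsrc a; qtgt a]%SET)
    (fun a => card_pair_ends (qsrc a) (qtgt a)).

Definition ugraph_iso (D D' : ugraph) : Prop :=
  exists (f : uvertex D -> uvertex D') (g : uedge D -> uedge D'),
    [/\ bijective f, bijective g
      & forall e, uends (g e) = (f @: uends e)%SET].

(* The graph on the vertices 0, ..., n whose edges are the entries of [es],
   one for each position; all entries are meant to be at most n. *)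
Definition ugraph_of_edges (n : nat) (es : seq (nat * nat)) : ugraph :=
  let p (k : 'I_(size es)) := nth (0%N, 0%N) es k in
  @UGraph 'I_n.+1 'I_(size es)
    (fun k => [set inord (p k).1; inord (p k).2]%SET)
    (fun k => card_pair_ends (inord (p k).1) (inord (p k).2)).

Definition tildeA (n : nat) : ugraph :=
  ugraph_of_edges n (rcons [seq (i, i.+1) | i <- iota 0 n] (n, 0%N)).

(* Vertex i here is vertex i + 1 in the usual numbering 1, ..., n + 1;
   meaningful for 4 <= n. *)
Definition tildeD (n : nat) : ugraph :=
  ugraph_of_edges n ([:: (0, 4); (1, 4); (2, n); (3, n)]%N
                     ++ [seq (i, i.+1) | i <- iota 4 (n - 4)]).

(* In the E series the central vertex is 0. *)
Definition tildeE6 : ugraph :=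
  ugraph_of_edges 6 [:: (0, 1); (1, 2); (0, 3); (3, 4); (0, 5); (5, 6)]%N.

Definition tildeE7 : ugraph :=
  ugraph_of_edges 7
    [:: (0, 1); (1, 2); (2, 3); (0, 4); (4, 5); (5, 6); (0, 7)]%N.

Definition tildeE8 : ugraph :=
  ugraph_of_edges 8
    [:: (0, 1); (1, 2); (2, 3); (3, 4); (4, 5); (0, 6); (6, 7); (0, 8)]%N.

Definition extended_dynkin (D : ugraph) : Prop :=
  (exists n, ugraph_iso D (tildeA n)) \/
  (exists2 n, (4 <= n)%N & ugraph_iso D (tildeD n)) \/
  ugraph_iso D tildeE6 \/ ugraph_iso D tildeE7 \/ ugraph_iso D tildeE8.

(* Complex Hilbert spaces: Banach spaces whose norm comes from an inner product
   (linear on the left). The library's norms take values in the scalars. *)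
Record hilbert (R : realType) := Hilbert {
  hspace :> completeNormedModType R[i];
  hdot : {dot hspace for (@Num.conj R[i])};
  hdot_norm : forall x : hspace, `|x| ^+ 2 = hdot x x }.

Definition bounded_operator (R : realType) (H K : hilbert R)
    (f : {linear H -> K}) : Prop :=
  exists M : R, forall x : H, `|f x| <= M%:C * `|x|.

Definition finite_dim (R : realType) (H : hilbert R) : Prop :=
  exists (n : nat) (b : 'I_n -> H), forall x : H,
    exists c : 'I_n -> R[i], x = \sum_(i < n) c i *: b i.

Record hilbert_rep (R : realType) (G : quiver) := HilbertRep {
  rspace : qvertex G -> hilbert R;
  rmap : forall a : qarrow G, {linear rspace (qsrc a) -> rspace (qtgt a)};
  rmap_bounded : forall a, bounded_operator (rmap a) }.

Section Representations.
Variables (R : realType) (G : quiver) (X : hilbert_rep R G).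

Definition is_endomorphism (T : forall v, {linear rspace X v -> rspace X v}) :
    Prop :=
  (forall v, bounded_operator (T v)) /\
  (forall a x, T (qtgt a) (rmap X a x) = rmap X a (T (qsrc a) x)).

Definition nonzero_rep : Prop := exists v, exists x : rspace X v, x != 0.

(* The second clause is the equality End(H, f) = C I. *)
Definition transitive_rep : Prop :=
  nonzero_rep /\
  forall T : forall v, {linear rspace X v -> rspace X v},
    is_endomorphism T <-> exists c : R[i], forall v x, T v x = c *: x.

Definition infinite_dim_rep : Prop := exists v, ~ finite_dim (rspace X v).

End Representations.

(* Main.v *)
Require Import Defs.
From HB Require Import structures.
From mathcomp Require Import all_boot all_order all_algebra.
From mathcomp Require Import complex.
From mathcomp Require Import all_classical all_reals all_analysis.
From mathcomp Require Import ring lra zify.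

Set Implicit Arguments.
Unset Strict Implicit.
Unset Printing Implicit Defensive.

Import Order.TTheory GRing.Theory Num.Theory.
Import numFieldNormedType.Exports.

Local Open Scope ring_scope.
Local Open Scope complex_scope.
Local Open Scope classical_set_scope.

(** Why the theorem is true.

On an oriented cycle with n + 1 vertices, let X be transitive and let Sh move
every component of a family (x_v) one arrow forward. Suppose that Sh^(k+1) is
a scalar. For a vector x0 and a functional phi the operator
   \sum_(j <= k) Sh^(k-j) (x0 (x) phi) Sh^j
commutes with Sh, since the commutator telescopes to
Sh^(k+1) (x0 (x) phi) - (x0 (x) phi) Sh^(k+1) = 0. Its diagonal blocks form an
endomorphism of finite rank, hence a scalar of finite rank. Take for k the
length of the longest walk along the cycle, of at most n arrows, whose operator
is not zero (longest_walk): if k < n then Sh^(k+1) = 0, and if k = n then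
Sh^(n+1) is itself an endomorphism of X, hence a scalar by transitivity. Choosing
x0 and phi so that x0 is fixed, the scalar is 1 and all the spaces are
finite-dimensional (cyclic_finite_dim).

All the other quivers get an infinite-dimensional transitive representation out
of one pair of operators on l2: the dilation D e_n = 2^-n e_n and the unilateral
shift S. If T' D = D T and T' S = S T with T, T' bounded, then T = T' is a scalar
(shift_pair_rigid). Indeed the matrix entries t_(m,n) of T vanish for m < n and
satisfy t_(m+1,n+1) = 2^(m-n) t_(m,n), so that a nonzero entry below the diagonal
would make the entries of its diagonal unbounded.

If a cycle is not cyclically oriented, some vertex is a source. Put l2 at every
vertex, D and S on the two arrows that leave this source, and the identity on the
other arrows (tildeA_transitive).

The remaining diagrams are stars with a centre K = l2^N, where for the D series
the centre may be stretched to a path carrying identities. A branch with k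
vertices is made to carry a flag 0 = U_0 < U_1 < ... < U_(k+1) = K: its vertex at
depth j gets a subquotient U_q / U_p with q - p = k + 1 - j. An arrow pointing
towards the centre is the inclusion of the subquotient that has lost its top
layer, an arrow pointing away from it is the projection onto the subquotient that
has lost its bottom layer. Whatever the orientation, each U_i with 0 < i <= k is
split off exactly once along the branch; therefore the endomorphisms of the
representation are the operators on K that preserve all the flags
(chain_compression, star_transitive). It remains to choose the flags such that
these operators are the scalars: in suitable coordinates two of them are opposite
coordinate flags, and the position of the others encodes the pair (D, S)
(e6_rigid, e7_rigid, e8_rigid, d_rigid). *)

(** * The Hilbert space of square-summable functions *)

Section CauchySchwarz.
Variables (R : realType) (U : lmodType R[i]) (dot : {dot U for (@Num.conj R[i])}).

Lemma dot_conj x y : dot x y = (dot y x)^*%R.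
Proof. by rewrite hermitian_subproof expr0 mul1r. Qed.

Lemma dotZl a x y : dot (a *: x) y = a * dot x y.
Proof. exact: linearZl_LR. Qed.

Lemma dotZr a x y : dot x (a *: y) = a^*%R * dot x y.
Proof. exact: linearZr_LR. Qed.

Lemma dot_ge0 x : 0 <= dot x x.
Proof. exact: dnorm_ge0. Qed.

(** The squared norm of <y, y> x - <x, y> y is nonnegative. *)
Lemma dot_CauchySchwarz x y : `|dot x y| ^+ 2 <= dot x x * dot y y.
Proof.
have [->|y0] := eqVneq y 0; first by rewrite !linear0r normr0 expr0n.
have yy : 0 < dot y y by rewrite dnorm_gt0.
have := dot_ge0 (dot y y *: x - dot x y *: y).
rewrite dnormB !(dotZl, dotZr).
have yyr : (dot y y)^*%R = dot y y by rewrite -dot_conj.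
have -> : (dot x y)^*%R = dot y x by rewrite -dot_conj.
rewrite !rmorphM /= yyr -!dot_conj.
have -> : `|dot x y| ^+ 2 = dot x y * dot y x by rewrite normCK -dot_conj.
set a := dot x x; set b := dot y y; set p := dot x y; set q := dot y x => h.
rewrite -(ler_pM2l yy) -subr_ge0.
by move: h; congr (0 <= _); rewrite -/b; ring.
Qed.

End CauchySchwarz.

Section SquareSum.
Variables (R : realType) (I : choiceType).
Implicit Types x y : I -> R[i].

Definition sqmod (z : R[i]) : R := complex.Re z ^+ 2 + complex.Im z ^+ 2.

Lemma sqmod_ge0 z : 0 <= sqmod z.
Proof. by rewrite addr_ge0 ?sqr_ge0. Qed.

Lemma sqmodM a b : sqmod (a * b) = sqmod a * sqmod b.
Proof. by case: a b => [a b] [c d]; rewrite /sqmod; simpc => /=; ring. Qed.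

Lemma sqmod_eq0 z : sqmod z = 0 -> z = 0.
Proof.
case: z => a b /eqP; rewrite paddr_eq0 ?sqr_ge0 // !sqrf_eq0 /=.
by move=> /andP[/eqP-> /eqP->].
Qed.

Definition sqsum x : \bar R := \esum_(i in setT) (sqmod (x i))%:E.

Lemma sqsum_ge0 x : (0 <= sqsum x)%E.
Proof. by apply: esum_ge0 => i _; rewrite lee_fin sqmod_ge0. Qed.

Lemma sqsumD_lty x y :
  (sqsum x < +oo -> sqsum y < +oo -> sqsum (x + y)%R < +oo)%E.
Proof.
move=> hx hy.
have le : (sqsum (x + y)%R <= (sqsum x + sqsum y) + (sqsum x + sqsum y))%E.
  rewrite /sqsum -esumD; try by move=> i _; rewrite lee_fin sqmod_ge0.
  rewrite -esumD; try by move=> i _; rewrite -EFinD lee_fin addr_ge0 ?sqmod_ge0.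
  apply: le_esum => i _; rewrite -!EFinD lee_fin fctE.
  case: (x i) (y i) => [a b] [c d]; rewrite /sqmod; simpc => /=.
  by have := sqr_ge0 (a - c); have := sqr_ge0 (b - d); nra.
by apply: le_lt_trans le _; rewrite !lte_add_pinfty.
Qed.

Lemma sqsumZ (a : R[i]) x : sqsum (a *: x) = ((sqmod a)%:E * sqsum x)%E.
Proof.
rewrite /sqsum /esum -ereal_supZl ?sqmod_ge0 //; last first.
  apply/set0P; exists 0%E, set0; last by rewrite fsbig_set0.
  by split => //; exact: finite_set0.
rewrite image_comp; congr ereal_sup; apply: eq_imagel => A _ /=.
rewrite ge0_mule_fsumr; last by move=> i; rewrite lee_fin sqmod_ge0.
by apply: eq_fsbigr => i _; rewrite -EFinM -sqmodM.
Qed.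

Lemma sqsum_ge x i : ((sqmod (x i))%:E <= sqsum x)%E.
Proof.
apply: esum_ge; exists [set i]; last by rewrite fsbig_set1.
by split => //; exact: finite_set1.
Qed.

(** The support is bounded by a predicate on one index type, instead of varying
    the index type, so that inclusions and projections between these spaces are
    both given by one truncation formula. *)
Definition l2_pred (P : pred I) : {pred I -> R[i]} :=
  fun x => `[< (sqsum x < +oo)%E /\ forall i, ~~ P i -> x i = 0 >].

Lemma l2_submod P : submod_closed (l2_pred P).
Proof.
split.
  apply/asboolP; split=> //.
  by rewrite /sqsum esum1 // => i _; rewrite /sqmod /= expr0n /= addr0.
move=> a x y /asboolP[xf x0] /asboolP[yf y0]; apply/asboolP; split.
  apply: sqsumD_lty yf; rewrite sqsumZ.
  by apply: lte_mul_pinfty xf => //; rewrite lee_fin sqmod_ge0.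
by move=> i Pi; rewrite fctE /= -[(a *: x) i]/(a * x i) x0 // y0 // mulr0 addr0.
Qed.

HB.instance Definition _ P := GRing.isSubmodClosed.Build R[i] (I -> R[i])
  (l2_pred P) (l2_submod P).

Record l2 (P : pred I) := L2 { l2fun :> I -> R[i]; l2funP : l2fun \in l2_pred P }.

HB.instance Definition _ P := [isSub for @l2fun P].
HB.instance Definition _ P := [Choice of l2 P by <:].
HB.instance Definition _ P := [SubChoice_isSubLmodule of l2 P by <:].

End SquareSum.

(** The inner product is recovered from the squared norm. The identities below
    involve only sums of values of Q with nonnegative coefficients, so that they
    pass from the summands |x_i|^2 to their possibly infinite sums without any
    discussion of convergence. *)
Section Polarization.
Variables (R : realType) (U : lmodType R[i]) (Q : U -> R).
Hypothesis Q_cubic : forall x y z,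
  Q (x + y + z) + Q x + Q y + Q z = Q (x + y) + Q (y + z) + Q (x + z).
Hypothesis Q_scale : forall a x, Q (a *: x) = sqmod a * Q x.
Hypothesis Q_shear : forall (s : R) x y,
  Q ((s ^+ 2)%:C *: x + y) + s ^+ 2 * Q x + s ^+ 2 * Q y =
  s ^+ 4 * Q x + Q y + s ^+ 2 * Q (x + y).

Definition polar_re x y : R := (Q (x + y) - Q x - Q y) / 2.
Local Notation B := polar_re.

Definition polar x y : R[i] := B x y +i* B x ('i%C *: y).

Let Q0 : Q 0 = 0.
Proof. by rewrite -(scale0r (0 : U)) Q_scale /sqmod /= !expr0n /= addr0 mul0r. Qed.

Let BC x y : B x y = B y x.
Proof. by rewrite /B [x + y]addrC; ring. Qed.

Let BD x y z : B (x + y) z = B x z + B y z.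
Proof. rewrite /B; have := Q_cubic x y z; lra. Qed.

Let B0 z : B 0 z = 0.
Proof. by rewrite /B add0r Q0; ring. Qed.

Let BN x z : B (- x) z = - B x z.
Proof. by apply/eqP; rewrite -addr_eq0 -BD addNr B0. Qed.

(** For t = s^2 the identity Q_shear is linear in the values of Q; the case of
    a negative t follows from additivity. *)
Let BZ (t : R) x z : B (t%:C *: x) z = t * B x z.
Proof.
have pos s : 0 <= s -> B (s%:C *: x) z = s * B x z.
  move=> s0; rewrite -(sqr_sqrtr s0); set r := Num.sqrt s.
  rewrite /B; have := Q_shear r x z; rewrite Q_scale.
  have -> : sqmod (r ^+ 2)%:C = r ^+ 4 by rewrite /sqmod /=; ring.
  lra.
have [/pos //|/ltW t0] := leP 0 t.
have -> : t%:C *: x = - ((- t)%:C *: x) by rewrite rmorphN scaleNr opprK.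
by rewrite BN pos ?oppr_ge0 // mulNr opprK.
Qed.

Let Qi x : Q ('i%C *: x) = Q x.
Proof. by rewrite Q_scale /sqmod /= expr0n /= add0r expr1n mul1r. Qed.

Let Bi x z : B ('i%C *: x) ('i%C *: z) = B x z.
Proof. by rewrite /B -scalerDr !Qi. Qed.

Let ii (x : U) : 'i%C *: ('i%C *: x) = - x.
Proof. by rewrite scalerA -expr2 sqr_i scaleN1r. Qed.

Let Bxi x : B x ('i%C *: x) = 0.
Proof. by have := Bi x ('i%C *: x); rewrite ii BC BN BC; lra. Qed.

Let Bil x z : B ('i%C *: x) z = - B x ('i%C *: z).
Proof. by rewrite -(Bi x) ii [B _ (- z)]BC BN BC opprK. Qed.

Lemma polarDl x y z : polar (x + y) z = polar x z + polar y z.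
Proof. by rewrite /polar !BD; simpc. Qed.

Lemma polarZl a x z : polar (a *: x) z = a * polar x z.
Proof.
case: a => u v.
have -> : (u +i* v) *: x = u%:C *: x + v%:C *: ('i%C *: x).
  by rewrite scalerA -scalerDl; congr (_ *: _); simpc.
by rewrite polarDl /polar !BZ Bi Bil; simpc; congr (_ +i* _); ring.
Qed.

Lemma polar_conj x y : polar x y = (polar y x)^*%R.
Proof. by rewrite /polar [B y x]BC [B y _]BC Bil -[in LHS](opprK (B x ('i%C *: y))). Qed.

Lemma polar_diag x : polar x x = (Q x)%:C.
Proof.
rewrite /polar Bxi /B.
have -> : x + x = 2%:R *: x by rewrite scaler_nat mulr2n.
by rewrite Q_scale /sqmod; congr (_ +i* _); rewrite /=; field.
Qed.

End Polarization.

Section L2.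
Variables (R : realType) (I : choiceType) (P : pred I).
Implicit Types x y z : l2 R P.

Lemma l2D x y i : (x + y) i = x i + y i. Proof. by []. Qed.
Lemma l2Z a x i : (a *: x) i = a * x i. Proof. by []. Qed.

Lemma l2B x y i : (x - y) i = x i - y i. Proof. by []. Qed.

Lemma l2_ext x y : (forall i, x i = y i) -> x = y.
Proof. by move=> xy; apply/val_inj/funext. Qed.

Lemma l2_out x i : ~~ P i -> x i = 0.
Proof. by have /asboolP[_] := l2funP x; apply. Qed.

Lemma l2_lty x : (sqsum x < +oo)%E.
Proof. by have /asboolP[] := l2funP x. Qed.

Definition sqnorm x : R := fine (sqsum x).

Lemma sqnormE x : (sqnorm x)%:E = sqsum x.
Proof. by rewrite fineK // ge0_fin_numE ?sqsum_ge0 // l2_lty. Qed.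

Lemma sqnorm_ge0 x : 0 <= sqnorm x.
Proof. by rewrite fine_ge0 // sqsum_ge0. Qed.

Lemma sqnorm_ge x i : sqmod (x i) <= sqnorm x.
Proof. by rewrite -lee_fin sqnormE sqsum_ge. Qed.

Lemma sqnorm_gt0 x : x != 0 -> 0 < sqnorm x.
Proof.
apply: contra_neqT; rewrite -leNgt => q; apply: l2_ext => i.
apply: sqmod_eq0; apply: le_anti; rewrite sqmod_ge0 andbT.
exact: le_trans (sqnorm_ge x i) q.
Qed.

Lemma sqnormZ a x : sqnorm (a *: x) = sqmod a * sqnorm x.
Proof. by apply: EFin_inj; rewrite EFinM !sqnormE sqsumZ. Qed.

Lemma sqnorm_cubic x y z :
  sqnorm (x + y + z) + sqnorm x + sqnorm y + sqnorm z =
  sqnorm (x + y) + sqnorm (y + z) + sqnorm (x + z).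
Proof.
apply: EFin_inj; rewrite !EFinD !sqnormE /sqsum.
rewrite -!esumD;
  try by move=> i _; rewrite -?EFinD lee_fin; do ?apply: addr_ge0; exact: sqr_ge0.
apply: eq_esum => i _; rewrite -!EFinD !l2D; congr _%:E.
by case: (x i) (y i) (z i) => [a b] [c d] [e f]; rewrite /sqmod; simpc => /=; ring.
Qed.

Lemma sqnorm_shear (s : R) x y :
  sqnorm ((s ^+ 2)%:C *: x + y) + s ^+ 2 * sqnorm x + s ^+ 2 * sqnorm y =
  s ^+ 4 * sqnorm x + sqnorm y + s ^+ 2 * sqnorm (x + y).
Proof.
have sc u : s ^+ 2 * sqnorm u = sqnorm (s%:C *: u).
  by rewrite sqnormZ /sqmod /= expr0n addr0.
have -> : s ^+ 4 * sqnorm x = sqnorm ((s ^+ 2)%:C *: x).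
  by rewrite sqnormZ /sqmod /=; ring.
rewrite !sc; apply: EFin_inj; rewrite !EFinD !sqnormE /sqsum.
rewrite -!esumD;
  try by move=> i _; rewrite -?EFinD lee_fin; do ?apply: addr_ge0; exact: sqr_ge0.
apply: eq_esum => i _; rewrite -!EFinD !(l2D, l2Z); congr _%:E.
by case: (x i) (y i) => [a b] [c d]; rewrite /sqmod; simpc => /=; ring.
Qed.

Definition l2dot x y : R[i] := polar sqnorm x y.

Lemma l2dot_bilinear : bilinear_for ( *%R ) (@Num.conj R[i] \; *%R) l2dot.
Proof.
have lD := polarDl sqnorm_cubic.
have lZ := polarZl sqnorm_cubic sqnormZ sqnorm_shear.
have lC := polar_conj sqnorm_cubic sqnormZ.
split=> u a x y /=; first by rewrite /l2dot lD lZ.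
by rewrite /l2dot lC lD lZ rmorphD rmorphM /= -!lC.
Qed.

HB.instance Definition _ := bilinear_isBilinear.Build R[i] (l2 R P) (l2 R P)
  R[i] _ _ l2dot l2dot_bilinear.

Lemma l2dot_hermitian x y : l2dot x y = (-1) ^+ false * (l2dot y x)^*%R.
Proof. by rewrite expr0 mul1r; exact: polar_conj sqnorm_cubic sqnormZ _ _. Qed.

HB.instance Definition _ := isHermitianSesquilinear.Build R[i] (l2 R P) false
  (@Num.conj R[i]) l2dot l2dot_hermitian.

Lemma l2dot_diag x : l2dot x x = (sqnorm x)%:C.
Proof. exact: polar_diag sqnorm_cubic sqnormZ _. Qed.

Lemma l2dot_gt0 x : x != 0 -> 0 < l2dot x x.
Proof. by move=> x0; rewrite l2dot_diag ltcR sqnorm_gt0. Qed.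

HB.instance Definition _ := isDotProduct.Build R[i] (l2 R P) l2dot l2dot_gt0.

Definition l2norm x : R := Num.sqrt (sqnorm x).

Lemma l2norm_ge0 x : 0 <= l2norm x. Proof. exact: sqrtr_ge0. Qed.

Lemma sqr_l2norm x : l2norm x ^+ 2 = sqnorm x.
Proof. by rewrite sqr_sqrtr // sqnorm_ge0. Qed.

Lemma l2normD x y : l2norm (x + y) <= l2norm x + l2norm y.
Proof.
rewrite -ler_sqr ?nnegrE ?addr_ge0 ?l2norm_ge0 // sqrrD !sqr_l2norm.
have cs : `|l2dot x y| ^+ 2 <= l2dot x x * l2dot y y.
  exact: dot_CauchySchwarz.
have -> : sqnorm (x + y) = sqnorm x + sqnorm y + 2 * complex.Re (l2dot x y).
  by rewrite /l2dot /polar /polar_re /=; field.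
rewrite [leRHS]addrAC lerD2l -[leRHS]mulr_natl ler_pM2l //.
apply: le_trans (ler_norm _) _.
rewrite -ler_sqr ?nnegrE ?mulr_ge0 ?l2norm_ge0 // exprMn !sqr_l2norm.
move: cs; rewrite !l2dot_diag -rmorphM -add_Re2_Im2 lecR; apply: le_trans.
by rewrite real_normK ?num_real // lerDl sqr_ge0.
Qed.

Lemma sqmod_norm (a : R[i]) : (Num.sqrt (sqmod a))%:C = `|a|.
Proof. by rewrite normc_def. Qed.

Lemma l2normZ a x : (l2norm (a *: x))%:C = `|a| * (l2norm x)%:C.
Proof. by rewrite -sqmod_norm -rmorphM /l2norm sqnormZ sqrtrM // sqmod_ge0. Qed.

Lemma l2norm_triangle x y :
  (l2norm (x + y))%:C <= (l2norm x)%:C + (l2norm y)%:C :> R[i].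
Proof. by rewrite -rmorphD lecR l2normD. Qed.

Lemma l2norm_eq0 x : (l2norm x)%:C = 0 :> R[i] -> x = 0.
Proof.
move=> /complexI/eqP; rewrite sqrtr_eq0 => x0.
by apply: contraTeq x0 => /sqnorm_gt0; rewrite -ltNge.
Qed.

HB.instance Definition _ := Lmodule_isNormed.Build R[i] (l2 R P)
  l2norm_triangle l2normZ l2norm_eq0.

Lemma l2_normE x : `|x| = (l2norm x)%:C. Proof. by []. Qed.

End L2.

Section Complete.
Variables (R : realType) (I : choiceType) (P : pred I).
Implicit Types x y z : l2 R P.

Lemma sqsum_le (x : I -> R[i]) (M : R) :
  (forall s : seq I, uniq s -> \sum_(i <- s) sqmod (x i) <= M) ->
  (sqsum x <= M%:E)%E.
Proof.
move=> h; apply: ge_ereal_sup => _ [A [Af _] <-].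
by rewrite fsbig_finite // sumEFin lee_fin h // fset_uniq.
Qed.

Lemma sum_sqmod_le (x : I -> R[i]) (s : seq I) : uniq s ->
  ((\sum_(i <- s) sqmod (x i))%:E <= sqsum x)%E.
Proof.
move=> us; apply: esum_ge; exists [set` s]; first by split.
by rewrite -sumEFin fsbig_seq.
Qed.

(** A Cauchy filter converges coordinatewise, and the bound on each finite partial
    sum of the squared distance survives in the limit. *)
Lemma l2_cauchy_cvg (F : set_system (l2 R P)) :
  ProperFilter F -> cauchy F -> cvg F.
Proof.
move=> FF Fc.
have small (e : R) : 0 < e -> exists2 A : set (l2 R P), F A &
    forall x y, A x -> A y -> l2norm (x - y) <= e.
  move=> e0.
  have e2 : 0 < (e / 2)%:C :> R[i] by rewrite ltcR divr_gt0.
  have [z zF] := (cauchyP F).1 Fc _ e2.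
  exists (ball z (e / 2)%:C) => // x y.
  rewrite -!ball_normE /ball_ /= => zx zy.
  rewrite -lecR -l2_normE.
  have -> : x - y = (z - y) - (z - x) by rewrite opprB [RHS]addrC addrA subrK.
  apply: le_trans (ler_normB _ _) _; apply: le_trans (lerD (ltW zy) (ltW zx)) _.
  by rewrite -rmorphD lecR -splitr.
have coord (g : R[i] -> R) i : {morph g : a b / a - b} ->
    (forall c : R[i], `|g c| <= Num.sqrt (sqmod c)) ->
    cvg ((fun x : l2 R P => g (x i)) @ F).
  move=> gB gle; apply/cauchy_cvgP/cauchy_exP => e e0.
  have [A FA Ae] := small (e / 2) (divr_gt0 e0 (ltr0n _ 2)).
  have [x Ax] := filter_ex FA.
  exists (g (x i)).
  suff : F [set y : l2 R P | ball (g (x i)) e (g (y i))] by [].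
  apply: filterS FA => y Ay; rewrite -ball_normE /ball_ /= -gB.
  apply: le_lt_trans (gle _) _; apply: (@le_lt_trans _ _ (e / 2)); last first.
    by rewrite ltr_pdivrMr // ltr_pMr // ltr1n.
  apply: le_trans (Ae x y Ax Ay); rewrite ler_sqrt ?sqnorm_ge0 // -l2B.
  exact: sqnorm_ge.
have /= Rc i : cvg ((fun x : l2 R P => complex.Re (x i)) @ F).
  apply: (coord (@complex.Re R)); first by case=> ? ? [].
  by move=> c; rewrite -sqrtr_sqr ler_sqrt ?sqmod_ge0 // lerDl sqr_ge0.
have /= Ic i : cvg ((fun x : l2 R P => complex.Im (x i)) @ F).
  apply: (coord (@complex.Im R)); first by case=> ? ? [].
  by move=> c; rewrite -sqrtr_sqr ler_sqrt ?sqmod_ge0 // lerDr sqr_ge0.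
pose l i : R[i] := lim ((fun x : l2 R P => complex.Re (x i)) @ F) +i*
            lim ((fun x : l2 R P => complex.Im (x i)) @ F).
have cvgl x i : (fun x' : l2 R P => sqmod ((x - x') i)) @ F --> sqmod (x i - l i).
  rewrite /sqmod !expr2.
  have cR : (fun x' : l2 R P => complex.Re ((x - x') i)) @ F -->
      complex.Re (x i - l i).
    have -> : (fun x' : l2 R P => complex.Re ((x - x') i)) =
        (fun x' : l2 R P => complex.Re (x i) - complex.Re (x' i)).
      by apply/funext => x'; rewrite l2B; case: (x i) (x' i) => ? ? [].
    have -> : complex.Re (x i - l i) = complex.Re (x i) - complex.Re (l i).
      by case: (x i).
    by apply: cvgB; [exact: cvg_cst|exact: Rc].
  have cI : (fun x' : l2 R P => complex.Im ((x - x') i)) @ F -->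
      complex.Im (x i - l i).
    have -> : (fun x' : l2 R P => complex.Im ((x - x') i)) =
        (fun x' : l2 R P => complex.Im (x i) - complex.Im (x' i)).
      by apply/funext => x'; rewrite l2B; case: (x i) (x' i) => ? ? [].
    have -> : complex.Im (x i - l i) = complex.Im (x i) - complex.Im (l i).
      by case: (x i).
    by apply: cvgB; [exact: cvg_cst|exact: Ic].
  by apply: cvgD; apply: cvgM.
have near_l (e : R) : 0 < e -> exists2 A : set (l2 R P), F A &
    forall x, A x -> (sqsum (l2fun x - l)%R <= (e ^+ 2)%:E)%E.
  move=> e0; have [A FA Ae] := small e e0; exists A => // x Ax.
  apply: sqsum_le => s us.
  have : (fun x' : l2 R P => \sum_(i <- s) sqmod ((x - x') i)) @ F -->
      \sum_(i <- s) sqmod ((l2fun x - l) i).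
    elim: s {us} => [|i s IH].
      under eq_fun do rewrite big_nil.
      by rewrite big_nil; exact: cvg_cst.
    under eq_fun do rewrite big_cons.
    by rewrite big_cons; apply: cvgD => //; exact: cvgl.
  move=> /cvgr_to_le; apply; apply: filterS FA => y Ay.
  rewrite -lee_fin; apply: le_trans (sum_sqmod_le _ us) _.
  rewrite -sqnormE lee_fin -sqr_l2norm ler_sqr ?nnegrE ?l2norm_ge0 ?(ltW e0) //.
  exact: Ae.
have lP : l \in l2_pred P.
  have [A FA Al] := near_l 1 ltr01; have [x Ax] := filter_ex FA.
  have xl : (l2fun x - l) \in l2_pred P.
    apply/asboolP; split; first exact: le_lt_trans (Al x Ax) (ltry _).
    move=> i iP; rewrite fctE l2_out // /l sub0r.
    have z0 (g : R[i] -> R) : g 0 = 0 -> lim ((fun x : l2 R P => g (x i)) @ F) = 0.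
      move=> g0; under eq_fun do rewrite l2_out //.
      by rewrite g0 lim_cst.
    by rewrite (z0 (@complex.Re R)) // (z0 (@complex.Im R)) //; exact: oppr0.
  by have := rpredB (l2funP x) xl; rewrite opprB addrC subrK.
apply/cvg_ex; exists (L2 lP : l2 R P).
apply/(@cvgrPdist_le _ (l2 R P) _ F _ id).
move=> eps eps0; have epsR := RRe_real (gtr0_real eps0).
have e0 : 0 < complex.Re eps by rewrite -ltcR epsR.
have [A FA Al] := near_l _ e0; apply: filterS FA => x Ax.
rewrite distrC l2_normE -epsR lecR -ler_sqr ?nnegrE ?l2norm_ge0 ?(ltW e0) //.
by rewrite sqr_l2norm -lee_fin sqnormE; exact: Al.
Qed.

HB.instance Definition _ := Uniform_isComplete.Build (l2 R P) l2_cauchy_cvg.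

Lemma l2_normsqE x : `|x| ^+ 2 = l2dot x x.
Proof. by rewrite l2dot_diag l2_normE -rmorphXn /= sqr_l2norm. Qed.

Definition l2H : hilbert R := @Hilbert R (l2 R P) (@l2dot R I P) l2_normsqE.

End Complete.

(** * Bounded operators *)

Section BoundedLinear.
Variable R : realType.
Implicit Types U V W : normedModType R[i].

(** Operators are handled as plain functions with a property, so that families
    indexed by vertices can be compared without transporting linear structures. *)
Definition bounded_linear U V (f : U -> V) : Prop :=
  linear f /\ exists M : R, forall x, `|f x| <= M%:C * `|x|.

Section Theory.
Variables (U V : normedModType R[i]) (f : U -> V) (hf : bounded_linear f).

Lemma blinP a x y : f (a *: x + y) = a *: f x + f y. Proof. exact: hf.1. Qed.
Lemma blinD x y : f (x + y) = f x + f y.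
Proof. by rewrite -[x]scale1r blinP !scale1r. Qed.
Lemma blin0 : f 0 = 0.
Proof. by apply: (@addrI _ (f 0)); rewrite -blinD !addr0. Qed.
Lemma blinZ a x : f (a *: x) = a *: f x.
Proof. by rewrite -[a *: x]addr0 blinP blin0 addr0. Qed.
Lemma blinN x : f (- x) = - f x.
Proof. by rewrite -scaleN1r blinZ scaleN1r. Qed.
Lemma blinB x y : f (x - y) = f x - f y.
Proof. by rewrite blinD blinN. Qed.
Lemma blin_sum (J : Type) (s : seq J) (g : J -> U) :
  f (\sum_(j <- s) g j) = \sum_(j <- s) f (g j).
Proof. exact: (big_morph f blinD blin0). Qed.

Definition blin_map : {linear U -> V} :=
  HB.pack f (GRing.isLinear.Build R[i] U V *:%R f hf.1).

Lemma blin_pos_bound : exists2 M : R, 0 <= M & forall x, `|f x| <= M%:C * `|x|.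
Proof.
have [_ [M hM]] := hf; exists (Num.max M 0); first by rewrite le_max lexx orbT.
move=> x; apply: le_trans (hM x) _; apply: ler_wpM2r => //.
by rewrite lecR le_max lexx.
Qed.

End Theory.

Lemma blin_id U : bounded_linear (@idfun U).
Proof. by split => // ; exists 1 => x; rewrite mul1r. Qed.

Lemma blin_zero U V : bounded_linear (fun _ : U => 0 : V).
Proof.
by split=> [a x y|]; [rewrite scaler0 addr0|exists 0 => x; rewrite normr0 mul0r].
Qed.

Lemma blin_comp U V W (g : V -> W) (f : U -> V) :
  bounded_linear g -> bounded_linear f -> bounded_linear (g \o f).
Proof.
move=> hg hf; split=> [a x y|]; first by rewrite /= (blinP hf) (blinP hg).
have [M M0 hM] := blin_pos_bound hf; have [N N0 hN] := blin_pos_bound hg.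
exists (N * M) => x; rewrite rmorphM -mulrA; apply: le_trans (hN _) _.
by rewrite ler_wpM2l // ler0c.
Qed.

Lemma blin_add U V (f g : U -> V) :
  bounded_linear f -> bounded_linear g -> bounded_linear (fun x => f x + g x).
Proof.
move=> hf hg; split=> [a x y|].
  by rewrite (blinP hf) (blinP hg) scalerDr addrACA.
have [_ [M hM]] := hf; have [_ [N hN]] := hg.
exists (M + N) => x; rewrite rmorphD mulrDl.
exact: le_trans (ler_normD _ _) (lerD _ _).
Qed.

Lemma blin_scale U V (c : R[i]) (f : U -> V) :
  bounded_linear f -> bounded_linear (fun x => c *: f x).
Proof.
move=> hf; split=> [a x y|].
  by rewrite (blinP hf) scalerDr !scalerA mulrC.
have [_ [M hM]] := hf; exists (Num.sqrt (sqmod c) * M) => x.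
by rewrite normrZ rmorphM /= sqmod_norm -mulrA ler_wpM2l.
Qed.

Lemma blin_opp U V (f : U -> V) :
  bounded_linear f -> bounded_linear (fun x => - f x).
Proof.
by move=> hf; under eq_fun do rewrite -scaleN1r; exact: blin_scale.
Qed.

Lemma blin_bigsum U V (J : Type) (s : seq J) (f : J -> U -> V) :
  (forall j, bounded_linear (f j)) ->
  bounded_linear (fun x => \sum_(j <- s) f j x).
Proof.
move=> hf; elim: s => [|j s IH].
  by under eq_fun do rewrite big_nil; exact: blin_zero.
by under eq_fun do rewrite big_cons; exact: blin_add.
Qed.

End BoundedLinear.

(** All the concrete operators below move coordinates along a partial injection and
    multiply them by weights of modulus at most 1; such an operator is a
    contraction. *)
Section WeightedReindexing.
Variables (R : realType) (I J : choiceType) (P : pred I) (P' : pred J).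
Variables (sigma : J -> option I) (w : J -> R[i]).
Hypothesis sigma_inj : forall j j' i,
  sigma j = Some i -> sigma j' = Some i -> j = j'.
Hypothesis w_le1 : forall j, sqmod (w j) <= 1.

Definition wreindex_fun (x : I -> R[i]) (j : J) : R[i] :=
  if P' j then oapp (fun i => w j * x i) 0 (sigma j) else 0.

Lemma sqsum_wreindex x : (sqsum (wreindex_fun x) <= sqsum x)%E.
Proof.
have [x_oo|] := eqVneq (sqsum x) +oo%E; first by rewrite x_oo leey.
rewrite -ltey => xfin; rewrite -[sqsum x]fineK ?ge0_fin_numE ?sqsum_ge0 //.
apply: sqsum_le => s us.
have us' : uniq (pmap sigma s).
  elim: s us => //= j s IH /andP[js us]; case E: (sigma j) => [i|] /=; last exact: IH.
  rewrite IH // andbT mem_pmap; apply/mapP => -[j' j's E'].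
  by move: js; rewrite (sigma_inj E (esym E')) j's.
apply: (@le_trans _ _ (\sum_(i <- pmap sigma s) sqmod (x i))).
  elim: s {us us'} => [|j s IH]; first by rewrite !big_nil.
  rewrite big_cons /= /wreindex_fun; case E: (sigma j) => [i|] /=.
    rewrite big_cons lerD //; case: ifP => _; last first.
      by rewrite {1}/sqmod /= expr0n addr0 sqmod_ge0.
    by rewrite sqmodM ler_piMl ?sqmod_ge0.
  by rewrite if_same {1}/sqmod /= expr0n /= addr0 add0r.
rewrite -lee_fin fineK ?ge0_fin_numE ?sqsum_ge0 //; exact: sum_sqmod_le.
Qed.

Lemma wreindex_l2 (x : l2 R P) : wreindex_fun x \in l2_pred P'.
Proof.
apply/asboolP; split; first exact: le_lt_trans (sqsum_wreindex x) (l2_lty x).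
by move=> j /negbTE jP; rewrite /wreindex_fun jP.
Qed.

Definition wreindex (x : l2 R P) : l2 R P' := L2 (wreindex_l2 x).

Lemma wreindexE x j : wreindex x j =
  if P' j then oapp (fun i => w j * x i) 0 (sigma j) else 0.
Proof. by []. Qed.

Lemma blin_wreindex : bounded_linear wreindex.
Proof.
split=> [a x y|].
  apply: l2_ext => j; rewrite l2D l2Z !wreindexE.
  case: (P' j); last by rewrite mulr0 addr0.
  case: (sigma j) => [i|] /=; last by rewrite mulr0 addr0.
  by change (w j * (a * x i + y i) = a * (w j * x i) + w j * y i); ring.
exists 1 => x; rewrite mul1r !l2_normE lecR ler_sqrt ?sqnorm_ge0 //.
by rewrite -lee_fin !sqnormE sqsum_wreindex.
Qed.

End WeightedReindexing.

Lemma some_inj (I : Type) (j j' i : I) :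
  Some j = Some i -> Some j' = Some i -> j = j'.
Proof. by move=> [->] [->]. Qed.

Section Density.
Variables (R : realType) (I : choiceType) (P : pred I).

Definition delta_fun (i j : I) : R[i] := ((j == i) && P j)%:R.

Lemma sqsum_delta i : (sqsum (delta_fun i) <= 1%:E)%E.
Proof.
apply: sqsum_le => s; elim: s => [|j s IH]; first by rewrite big_nil.
have sq0 : sqmod (0 : R[i]) = 0 by rewrite /sqmod /= expr0n addr0.
rewrite /= big_cons => /andP[js us].
have [ji|ji] := eqVneq j i; last by rewrite {1}/delta_fun (negbTE ji) sq0 add0r IH.
rewrite big_seq big1 ?addr0; last first.
  move=> k ks; rewrite /delta_fun; case: eqVneq => [ki|]; last by rewrite sq0.
  by move: js; rewrite ji -ki ks.
by rewrite /delta_fun; case: (_ && _); rewrite ?sq0 // /sqmod /= expr1n expr0n addr0.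
Qed.

Lemma delta_l2 i : delta_fun i \in l2_pred P.
Proof.
apply/asboolP; split; last by move=> j /negbTE jP; rewrite /delta_fun jP andbF.
exact: le_lt_trans (sqsum_delta i) (ltry _).
Qed.

Definition delta i : l2 R P := L2 (delta_l2 i).

Lemma deltaE i j : delta i j = ((j == i) && P j)%:R. Proof. by []. Qed.

Lemma l2_sumE (J : Type) (s : seq J) (g : J -> l2 R P) i :
  (\sum_(j <- s) g j) i = \sum_(j <- s) g j i.
Proof. exact: (big_morph (fun x : l2 R P => x i)). Qed.

Lemma sqsum_ge_sum (x : l2 R P) (s : seq I) : uniq s ->
  \sum_(i <- s) sqmod (x i) <= sqnorm x.
Proof. by move=> us; rewrite -lee_fin sqnormE; exact: sum_sqmod_le. Qed.

(** The vectors delta i span a dense subspace. *)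
Lemma blin_ext0 (V : normedModType R[i]) (f : l2 R P -> V) :
  bounded_linear f -> (forall i, P i -> f (delta i) = 0) -> forall x, f x = 0.
Proof.
move=> hf f0 x; have [M M0 hM] := blin_pos_bound hf.
(* Off a finite set carrying almost all of the norm of x, the vector x is small. *)
have tail (e : R) : 0 < e -> `|f x| <= (M * Num.sqrt e)%:C.
  move=> e0.
  have [s us xs] : exists2 s : seq I, uniq s &
      sqnorm x - e < \sum_(i <- s) sqmod (x i).
    apply: contrapT => no.
    have : (sqsum x <= (sqnorm x - e)%:E)%E.
      apply: sqsum_le => s us; rewrite leNgt; apply/negP => lt.
      by apply: no; exists s.
    by rewrite -sqnormE lee_fin lerBrDr gerDl leNgt e0.
  have w1 j : sqmod ((j \notin s)%:R : R[i]) <= 1.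
    by case: (_ \notin _); rewrite /sqmod /= ?expr1n ?expr0n ?addr0.
  pose t : l2 R P := @wreindex R I I P P Some (fun j => (j \notin s)%:R)
    (@some_inj I) w1 x.
  have tE j : t j = if P j then (j \notin s)%:R * x j else 0 by [].
  have xE : x = t + \sum_(i <- s) x i *: delta i.
    apply: l2_ext => j; rewrite l2D l2_sumE tE.
    under eq_bigr do rewrite l2Z deltaE.
    have [Pj|/[dup] nPj /negbTE Pj] := boolP (P j); last first.
      rewrite (l2_out x) // add0r big1 // => i _.
      by rewrite andbF mulr0.
    have [js|js] := boolP (j \in s).
      rewrite mul0r add0r (bigD1_seq j) //= eqxx mulr1 big1 ?addr0 // => i ij.
      by rewrite eq_sym (negbTE ij) mulr0.
    rewrite mul1r big_seq big1 ?addr0 // => i is_.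
    by case: eqVneq => [ji|]; rewrite ?mulr0 //; move: js; rewrite ji is_.
  have -> : f x = f t.
    rewrite {1}xE (blinD hf) (blin_sum hf) big1 ?addr0 // => i _.
    have [/f0 fi|/(l2_out x) xi] := boolP (P i).
      by rewrite (blinZ hf) fi scaler0.
    by rewrite xi scale0r (blin0 hf).
  apply: le_trans (hM t) _; rewrite rmorphM /=.
  apply: ler_wpM2l; first by rewrite ler0c.
  rewrite l2_normE lecR ler_sqrt ?(ltW e0) // -lee_fin sqnormE.
  apply: sqsum_le => r ur.
  apply: (@le_trans _ _ (\sum_(j <- [seq j <- r | j \notin s]) sqmod (x j))).
    rewrite big_filter [leRHS]big_mkcond; apply: ler_sum => j _.
    rewrite tE; case: (j \in s) => /=; case: (P j); rewrite ?mul0r ?mul1r ?sqmod_ge0 //.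
    - by rewrite /sqmod /= expr0n addr0.
    - by rewrite /sqmod /= expr0n addr0.
    - by rewrite {1}/sqmod /= expr0n addr0 sqmod_ge0.
  rewrite -(lerD2r (\sum_(i <- s) sqmod (x i))) -big_cat /=.
  apply: (@le_trans _ _ (sqnorm x)); last by rewrite -lerBlDl ltW.
  apply: sqsum_ge_sum; rewrite cat_uniq filter_uniq //= us andbT.
  by apply/hasPn => j js; rewrite mem_filter js.
apply/eqP; rewrite -normr_eq0; apply/eqP.
have nr : `|f x| \is Num.real by exact: normr_real.
rewrite -(RRe_real nr); congr (_%:C); apply/eqP; rewrite eq_le.
apply/andP; split; last first.
  by rewrite -lecR RRe_real //; exact: normr_ge0.
apply/ler_addgt0Pl => e e0; rewrite ?addr0 ?add0r -lecR RRe_real //.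
have d0 : 0 < (e / (M + 1)) ^+ 2 by rewrite exprn_gt0 // divr_gt0 // ltr_wpDl.
apply: le_trans (tail _ d0) _; rewrite lecR sqrtr_sqr ger0_norm; last first.
  by rewrite divr_ge0 ?addr_ge0 // ltW.
rewrite mulrCA ger_pMr // ler_pdivrMr ?mul1r ?lerDl //.
by rewrite ltr_wpDl.
Qed.

End Density.

(** * A rigid pair of operators *)

Section ShiftPair.
Variable R : realType.

Definition ell2 := l2 R (predT : pred nat).

Definition half_pow (n : nat) : R[i] := (2^-1 ^+ n)%:C.

Lemma half_pow_le1 n : sqmod (half_pow n) <= 1.
Proof.
rewrite /sqmod /= expr0n addr0 -exprM; apply: exprn_ile1 => //.
by rewrite invf_le1 // ler1n.
Qed.

Definition dilation : ell2 -> ell2 :=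
  wreindex predT (@some_inj nat) half_pow_le1.

Definition pred_opt (n : nat) : option nat := if n is m.+1 then Some m else None.

Lemma pred_opt_inj j j' i : pred_opt j = Some i -> pred_opt j' = Some i -> j = j'.
Proof. by case: j j' => [|j] [|j'] //= [->] [->]. Qed.

Lemma sqmod1 : sqmod (1 : R[i]) <= 1.
Proof. by rewrite /sqmod /= expr1n expr0n addr0. Qed.

Definition ushift : ell2 -> ell2 :=
  wreindex predT pred_opt_inj (fun=> sqmod1).

Lemma blin_dilation : bounded_linear dilation. Proof. exact: blin_wreindex. Qed.
Lemma blin_ushift : bounded_linear ushift. Proof. exact: blin_wreindex. Qed.

Lemma dilationE x n : dilation x n = half_pow n * x n. Proof. by []. Qed.
Lemma ushift0 x : ushift x 0%N = 0. Proof. by []. Qed.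
Lemma ushiftS x n : ushift x n.+1 = x n.
Proof. by rewrite /ushift wreindexE /= mul1r. Qed.

Lemma half_powD m n : half_pow (m + n) = half_pow m * half_pow n.
Proof. by rewrite /half_pow exprD rmorphM. Qed.

Lemma half_pow_neq0 n : half_pow n != 0.
Proof. by rewrite /half_pow fmorph_eq0 expf_neq0 // invr_neq0. Qed.

Lemma half_pow0 : half_pow 0 = 1. Proof. by rewrite /half_pow expr0. Qed.

Lemma norm_coord_le (I : choiceType) (P : pred I) (x : l2 R P) i : `|x i| <= `|x|.
Proof. by rewrite -sqmod_norm l2_normE lecR ler_sqrt ?sqnorm_ge0 // sqnorm_ge. Qed.

Lemma dilation_delta n : dilation (delta R predT n) = half_pow n *: delta R predT n.
Proof.
apply: l2_ext => j; rewrite dilationE l2Z !deltaE.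
by case: eqVneq => [->|] //; rewrite !mulr0.
Qed.

Lemma ushift_delta n : ushift (delta R predT n) = delta R predT n.+1.
Proof. by apply: l2_ext => -[|j] //; rewrite ushiftS !deltaE. Qed.

Lemma norm_delta (n : nat) : `|delta R predT n| <= 1.
Proof.
rewrite l2_normE lecR -[leRHS]sqrtr1 ler_sqrt // -lee_fin sqnormE.
exact: sqsum_delta.
Qed.

Lemma le_half_pow_eq0 (z : R[i]) (M : R) :
  (forall n, `|z| <= half_pow n * M%:C) -> z = 0.
Proof.
move=> h; apply/eqP; rewrite -normr_eq0.
have zr : `|z| = (Num.sqrt (sqmod z))%:C by rewrite sqmod_norm.
rewrite zr in h *; move: (Num.sqrt (sqmod z)) (sqrtr_ge0 (sqmod z)) h => r r0 h.
rewrite -[0]/(0%:C) (inj_eq (@complexI R)) eq_le r0 andbT.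
have h2 n : r * n%:R <= M.
  have := h n; rewrite -rmorphM lecR exprVn mulrC ler_pdivlMr ?exprn_gt0 //.
  apply: le_trans; apply: ler_wpM2l => //.
  by rewrite -natrX ler_nat ltnW // ltn_expl.
rewrite leNgt; apply/negP => rp.
have := h2 (Num.bound (M / r)); rewrite mulrC -ler_pdivlMr // leNgt.
by rewrite archi_boundP // divr_ge0 //; have := h2 0%N; rewrite mulr0.
Qed.

(** The pair (dilation, ushift) is a transitive representation of the Kronecker
    quiver. The shift being one-sided, the matrix of T has no entries above the
    diagonal; and k steps below it the entries are multiplied by 2^k from each column
    to the next, which a bounded operator only allows for k = 0. *)
Theorem shift_pair_rigid (T T' : ell2 -> ell2) :
  bounded_linear T -> bounded_linear T' ->
  (forall x, T' (dilation x) = dilation (T x)) ->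
  (forall x, T' (ushift x) = ushift (T x)) ->
  exists c : R[i], forall x, T x = c *: x /\ T' x = c *: x.
Proof.
move=> hT hT' TD TS.
pose e (n : nat) : ell2 := delta R predT n.
pose t m n := T (e n) m; pose s m n := T' (e n) m.
have sD m n : half_pow n * s m n = half_pow m * t m n.
  have := congr1 (fun x : ell2 => x m) (TD (e n)).
  by rewrite /e dilation_delta (blinZ hT') l2Z dilationE.
have s0 n : s 0%N n.+1 = 0.
  by have := congr1 (fun x : ell2 => x 0%N) (TS (e n)); rewrite /e ushift_delta ushift0.
have sS m n : s m.+1 n.+1 = t m n.
  by have := congr1 (fun x : ell2 => x m.+1) (TS (e n)); rewrite /e ushift_delta ushiftS.
have t0 n : t 0%N n.+1 = 0 by rewrite -[LHS]mul1r -half_pow0 -sD s0 mulr0.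
have tS m n : half_pow m.+1 * t m.+1 n.+1 = half_pow n.+1 * t m n.
  by rewrite -sD sS.
have t_upper m n : (m < n)%N -> t m n = 0.
  elim: m n => [|m IH] [|n] //; rewrite ltnS => mn.
  by apply: (mulfI (half_pow_neq0 m.+1)); rewrite tS IH // !mulr0.
have t_lower k n : t k 0%N = half_pow (k * n) * t (n + k)%N n.
  elim: n => [|n IH]; first by rewrite muln0 half_pow0 mul1r.
  rewrite {}IH; apply: (mulfI (half_pow_neq0 n.+1)).
  rewrite mulrCA -tS mulrA -half_powD mulrA -half_powD addSn.
  by congr (half_pow _ * _); lia.
have [M M0 hM] := blin_pos_bound hT.
have t_le m n : `|t m n| <= M%:C.
  apply: le_trans (norm_coord_le _ _) _; apply: le_trans (hM _) _.
  by rewrite ler_piMr ?ler0c ?norm_delta.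
have t_col k : t k.+1 0%N = 0.
  apply: (@le_half_pow_eq0 _ M) => n; rewrite (t_lower _ n) normrM.
  have hp m : 0 <= half_pow m by rewrite ler0c exprn_ge0.
  rewrite ger0_norm // ler_pM // lecR mulSn exprD ger_pMr ?exprn_gt0 //.
  by rewrite exprn_ile1 // invf_le1 // ler1n.
have t_diag m n : t m n = (m == n)%:R * t 0%N 0%N.
  have [mn|nm|->] := ltngtP m n.
  - by rewrite t_upper // mul0r.
  - apply: (mulfI (half_pow_neq0 ((m - n).-1.+1 * n))).
    have mE : m = (n + (m - n).-1.+1)%N by lia.
    by rewrite {2}mE -t_lower t_col mul0r mulr0.
  - by rewrite (t_lower 0%N n) mul0n half_pow0 addn0 !mul1r.
(* The matrix of T is a scalar one; by density so is T, and T' has the same matrix. *)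
have diag_scalar (A : ell2 -> ell2) : bounded_linear A ->
    (forall m n, A (e n) m = t m n) -> forall x, A x = t 0%N 0%N *: x.
  move=> hA At x; apply/eqP; rewrite -subr_eq0; apply/eqP.
  apply: (blin_ext0 (f := fun x => A x - t 0%N 0%N *: x)).
    apply: blin_add hA _; apply: blin_opp; apply: blin_scale; exact: blin_id.
  move=> n _; apply: l2_ext => m; rewrite l2B l2Z At t_diag deltaE andbT mulrC.
  by rewrite subrr.
exists (t 0%N 0%N) => x; split; first exact: diag_scalar.
apply: diag_scalar => // m n; apply: (mulfI (half_pow_neq0 n)).
by rewrite [LHS]sD t_diag; case: eqVneq => [->|] //; rewrite mul0r !mulr0.
Qed.

End ShiftPair.

(** * Representations by compressions of operators on one space *)

Section InfiniteDim.
Variables (R : realType) (I : choiceType) (P : pred I).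

(** n + 1 of the vectors delta (e k) cannot be combinations of n vectors, since an
    (n + 1) by n matrix has a nonzero row kernel. *)
Lemma l2_infinite_dim (e : nat -> I) :
  injective e -> (forall n, P (e n)) -> ~ finite_dim (l2H R P).
Proof.
move=> e_inj Pe [n [b hb]].
have [c hc] := choice (fun k : 'I_n.+1 => hb (delta R P (e k))).
pose C : 'M[R[i]]_(n.+1, n) := \matrix_(k, i) c k i.
have /rowV0Pn[u /sub_kermxP uC u0] : kermx C != 0.
  rewrite -mxrank_eq0 mxrank_ker subn_eq0 -ltnNge ltnS; exact: rank_leq_col.
have sum0 : \sum_k u 0 k *: delta R P (e k) = 0.
  under eq_bigr do rewrite hc scaler_sumr.
  rewrite exchange_big /= big1 // => i _.
  under eq_bigr do rewrite scalerA.
  have uCi : \sum_k u 0 k * c k i = 0.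
    have /matrixP/(_ 0 i) := uC; rewrite !mxE => uc; rewrite -[RHS]uc.
    by apply: eq_bigr => k _; rewrite mxE.
  by rewrite -scaler_suml uCi scale0r.
case/negP: u0; apply/eqP/rowP => k; rewrite mxE.
have := congr1 (fun x : l2 R P => x (e k)) sum0; rewrite l2_sumE.
under eq_bigr do rewrite l2Z deltaE Pe andbT (inj_eq e_inj) (inj_eq val_inj).
rewrite (bigD1 k) //= eqxx mulr1 big1 ?addr0 // => j jk.
by rewrite eq_sym (negbTE jk) mulr0.
Qed.

End InfiniteDim.

Section Truncation.
Variables (R : realType) (I : choiceType).

Definition truncate (P P' : pred I) : l2 R P -> l2 R P' :=
  wreindex P' (@some_inj I) (fun=> sqmod1 R).

Lemma truncateE P P' (x : l2 R P) i : truncate P' x i = if P' i then x i else 0.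
Proof. by rewrite /truncate wreindexE /= mul1r. Qed.

Lemma blin_truncate P P' : bounded_linear (@truncate P P').
Proof. exact: blin_wreindex. Qed.

Definition cutoff (P : pred I) (x : l2 R predT) : l2 R predT :=
  truncate predT (truncate P x).

Lemma cutoffE P x i : cutoff P x i = if P i then x i else 0.
Proof. by rewrite /cutoff !truncateE. Qed.

Lemma blin_cutoff P : bounded_linear (cutoff P).
Proof. by apply: (blin_comp (g := @truncate P predT)); exact: blin_truncate. Qed.

Lemma cutoff_predT x : cutoff predT x = x.
Proof. by apply: l2_ext => i; rewrite cutoffE. Qed.

Lemma truncateK P : cancel (@truncate P predT) (@truncate predT P).
Proof.
move=> x; apply: l2_ext => i; rewrite !truncateE.
by case: ifPn => // /l2_out ->.
Qed.

End Truncation.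

(** The space at v is the part of one space K supported on P v, and all the maps are
    compressions of operators on K. Endomorphisms then become families of operators
    on the same space K, and equalities between vertices can be rewritten. *)
Section CompressedRepresentation.
Variables (R : realType) (G : quiver) (I : choiceType).
Local Notation K := (l2 R (predT : pred I)).
Variables (P : qvertex G -> pred I) (F : qarrow G -> K -> K).
Hypothesis F_blin : forall a, bounded_linear (F a).

Lemma compressed_map_blin a : bounded_linear
  (@truncate R I predT (P (qtgt a)) \o (F a \o @truncate R I (P (qsrc a)) predT)).
Proof. by do 2?[apply: blin_comp => //]; exact: blin_truncate. Qed.

Definition compressed_rep : hilbert_rep R G :=
  @HilbertRep R G (fun v => l2H R (P v))
    (fun a => blin_map (compressed_map_blin a))
    (fun a => (compressed_map_blin a).2).

Hypothesis rigid : forall T : qvertex G -> K -> K,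
  (forall v, bounded_linear (T v)) ->
  (forall v x, T v (cutoff (P v) x) = T v x) ->
  (forall v x, cutoff (P v) (T v x) = T v x) ->
  (forall a x, T (qtgt a) (F a (cutoff (P (qsrc a)) x)) =
               cutoff (P (qtgt a)) (F a (T (qsrc a) x))) ->
  exists c, forall v x, T v x = c *: cutoff (P v) x.

Variables (v0 : qvertex G) (e : nat -> I).
Hypotheses (e_inj : injective e) (e_in : forall n, P v0 (e n)).

Lemma compressed_rep_transitive :
  infinite_dim_rep compressed_rep /\ transitive_rep compressed_rep.
Proof.
split; first by exists v0; exact: (l2_infinite_dim e_inj e_in).
split.
  exists v0, (delta R (P v0) (e 0)); apply/eqP.
  move=> /(congr1 (fun x : l2 R (P v0) => x (e 0))).
  by rewrite deltaE eqxx e_in => /eqP; rewrite oner_eq0.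
move=> T; split; last first.
  move=> [c Tc]; split=> [v|a x]; last by rewrite !Tc linearZ.
  exists (Num.sqrt (sqmod c)) => x; rewrite Tc normrZ.
  by rewrite sqmod_norm.
move=> [Tb Tc].
have Tblin v : bounded_linear (T v) by split; [exact: linearP|exact: Tb].
pose T' v : K -> K := @truncate R I (P v) predT \o (T v \o @truncate R I predT (P v)).
have [||||c hc] := rigid (T := T').
- move=> v; apply: blin_comp (blin_truncate _ _ _) _.
  exact: blin_comp (Tblin v) (blin_truncate _ _ _).
- by move=> v x; rewrite /T' /= /cutoff truncateK.
- by move=> v x; rewrite /T' /= /cutoff truncateK.
- move=> a x; rewrite /T' /=.
  exact: (congr1 (@truncate R I (P (qtgt a)) predT)
    (Tc a (truncate (P (qsrc a)) x))).
exists c => v x; apply: (can_inj (@truncateK R I (P v))).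
have := hc v (truncate predT x); rewrite /T' /= truncateK => ->.
by rewrite /cutoff truncateK (blinZ (blin_truncate _ _ _)).
Qed.

End CompressedRepresentation.

(** * Cycles that are not cyclically oriented *)

Section TildeA.
Variable R : realType.

Lemma set2_eq (T : finType) (a b c d : T) : [set a; b]%SET = [set c; d]%SET ->
  (a = c /\ b = d) \/ (a = d /\ b = c).
Proof.
move=> e; have := set21 a b; have := set22 a b; have := set21 c d; have := set22 c d.
rewrite {1 2}e -{1 2}e !in_set2 => /pred2P hd /pred2P hc /pred2P hb /pred2P ha.
by case: hd hc hb ha => -> [] -> [] ? [] ?; subst; auto.
Qed.

Lemma val_iter_ordS n (k : 'I_n.+1) m :
  val (iter m (@ordS n.+1) k) = ((k + m) %% n.+1)%N.
Proof.
elim: m => [|m IH]; first by rewrite addn0 modn_small.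
by rewrite /= IH -[X in (X %% _)%N = _]addn1 modnDml addn1 addnS.
Qed.

Lemma ordS_ind n (Q : 'I_n.+1 -> Prop) k :
  (forall j, Q j -> Q (ordS j)) -> Q k -> forall j, Q j.
Proof.
move=> QS Qk j.
have Qi m : Q (iter m (@ordS n.+1) k) by elim: m => //= m; exact: QS.
have -> : j = iter (j + (n.+1 - k)) (@ordS n.+1) k; last exact: Qi.
apply: val_inj; rewrite val_iter_ordS addnCA subnKC ?modnDr ?modn_small //.
exact: ltnW.
Qed.

(** Reversing the numbering turns the predecessor into the successor: a cycle with
    all its arrows backward is an oriented cycle too. *)
Lemma ordS_rev n (x : 'I_n.+1) : ordS (rev_ord (ordS x)) = rev_ord x.
Proof.
apply: val_inj => /=; have := ltn_ord x; rewrite ltnS leq_eqVlt => /orP[/eqP->|xn].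
  by rewrite modnn subSS subn0 modnn subnn.
by rewrite (@modn_small x.+1) // !subSS subnSK // modn_small // ltnS leq_subr.
Qed.

Lemma tildeA_labels (G : quiver) n : ugraph_iso (underlying G) (tildeA n) ->
  exists (f : qvertex G -> 'I_n.+1) (l : qarrow G -> 'I_n.+1),
  [/\ bijective f, bijective l &
   forall a, [set f (qsrc a); f (qtgt a)]%SET = [set l a; ordS (l a)]%SET].
Proof.
have sz : size (rcons [seq (i, i.+1) | i <- iota 0 n] (n, 0)%N) = n.+1.
  by rewrite size_rcons size_map size_iota.
move=> [f [g [bf bg fg]]]; exists f, (fun a => cast_ord sz (g a)); split => //.
  have bc : bijective (cast_ord sz) by exists (cast_ord (esym sz)) => x; apply: val_inj.
  exact: bij_comp bc bg.
move=> a; have := fg a; rewrite /= imsetU1 imset_set1 => <-.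
have := ltn_ord (cast_ord sz (g a)); rewrite ltnS leq_eqVlt => /orP[/eqP e|lt].
  have en : nat_of_ord (g a) = n by [].
  rewrite en nth_rcons size_map size_iota ltnn eqxx.
  congr ([set _; _])%SET; apply: val_inj; rewrite /= inordK //.
  by rewrite en modnn.
have en : (g a < n)%N by [].
rewrite nth_rcons size_map size_iota en (nth_map 0%N) ?size_iota // nth_iota //.
congr ([set _; _])%SET; apply: val_inj; rewrite /= inordK //.
  by rewrite ltnW.
by rewrite modn_small.
Qed.

(** If being backward propagated from each arrow to the next one, all the arrows would
    have the same direction. So some backward arrow k is followed by a forward one,
    and their common end is a source; it is the vertex v below. *)
Lemma tildeA_transitive (G : quiver) n : ugraph_iso (underlying G) (tildeA n) ->
  ~ oriented_cyclic G ->
  exists X : hilbert_rep R G, infinite_dim_rep X /\ transitive_rep X.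
Proof.
move=> /tildeA_labels[f [l [bf [arr lK arrK] ends]]] nc.
have f_inj := bij_inj bf; have [vtx fK vtxK] := bf.
pose bwd j := f (qsrc (arr j)) = ordS j /\ f (qtgt (arr j)) = j.
have fwd j : ~ bwd j -> f (qsrc (arr j)) = j /\ f (qtgt (arr j)) = ordS j.
  by move=> nb; case: (set2_eq (ends (arr j))); rewrite arrK // => /nb.
have [k [bk nbk]] : exists k, bwd k /\ ~ bwd (ordS k).
  apply: contrapT => no.
  have step j : bwd j -> bwd (ordS j).
    by move=> bj; apply: contrapT => nb; apply: no; exists j.
  apply: nc; exists n.
  have [[k bk]|nob] := pselect (exists k, bwd k).
    have allb := ordS_ind step bk.
    exists (@rev_ord n.+1 \o f), (@rev_ord n.+1 \o (@ordS n.+1 \o l)).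
    have brev : bijective (@rev_ord n.+1) by exists (@rev_ord n.+1); exact: rev_ordK.
    have bS : bijective (@ordS n.+1).
      by exists (@ord_pred n.+1); [exact: ordSK|exact: ord_predK].
    split; [exact: bij_comp|do 2?[apply: bij_comp => //]; by exists arr| |] => a /=.
      by have [<- _] := allb (l a); rewrite lK.
    by have [_] := allb (l a); rewrite lK ordS_rev => ->.
  exists f, l; split => //; first by exists arr.
    move=> a; have [|+ _] := fwd (l a); first by move=> b; apply: nob; exists (l a).
    by rewrite lK => ->.
  move=> a; have [|_] := fwd (l a); first by move=> b; apply: nob; exists (l a).
  by rewrite lK => ->.
have [sb tb] := fwd _ nbk; have [sa ta] := bk.
pose F a : ell2 R -> ell2 R :=
  if l a == k then @dilation R else if l a == ordS k then @ushift R else idfun.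
have F_blin a : bounded_linear (F a).
  rewrite /F; case: ifP => _; first exact: blin_dilation.
  by case: ifP => _; [exact: blin_ushift|exact: blin_id].
have kS : ordS k != k.
  apply/eqP => e; apply: nbk; rewrite /bwd.
  by case: (set2_eq (ends (arr (ordS k)))); rewrite arrK // !e.
exists (compressed_rep (fun=> predT) F_blin).
apply: (@compressed_rep_transitive _ _ _ _ _ _ _ (vtx k) id) => //.
move=> T Tb _ _ Tc.
have {}Tc a x : T (qtgt a) (F a x) = F a (T (qsrc a) x).
  by have := Tc a x; rewrite !cutoff_predT.
pose v := vtx (ordS k); pose w := vtx (ordS (ordS k)).
pose Q j := vtx j = v \/ (forall x, T (vtx j) x = T w x).
have Qw : Q (ordS (ordS k)) by right.
have others : forall j, Q j.
  apply: (ordS_ind _ Qw) => j IH.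
  have [->|jk] := eqVneq j k; first by left.
  have [->|jSk] := eqVneq j (ordS k); first by right.
  right => x; have := Tc (arr j) x; rewrite /F arrK (negbTE jk) (negbTE jSk) /=.
  case: IH => [/(can_inj vtxK) e|<-]; first by rewrite e eqxx in jSk.
  rewrite -(fK (qsrc (arr j))) -(fK (qtgt (arr j))).
  by have := set2_eq (ends (arr j)); rewrite arrK => -[] [-> ->] => ->.
have srca : qsrc (arr k) = v by rewrite -(fK (qsrc (arr k))) sa.
have tgtb : qtgt (arr (ordS k)) = w by rewrite -(fK (qtgt (arr (ordS k)))) tb.
have srcb : qsrc (arr (ordS k)) = v by rewrite -(fK (qsrc (arr (ordS k)))) sb.
have tgta x : T (qtgt (arr k)) x = T w x.
  rewrite -(fK (qtgt (arr k))) ta; case: (others k) => // /(can_inj vtxK) e.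
  by rewrite -e eqxx in kS.
have [||c hc] := shift_pair_rigid (Tb v) (Tb w).
- move=> x; have := Tc (arr k) x; rewrite /F arrK eqxx.
  by rewrite srca tgta.
- move=> x; have := Tc (arr (ordS k)) x; rewrite /F arrK eqxx (negbTE kS).
  by rewrite srcb tgtb.
exists c => u x; rewrite cutoff_predT -(fK u).
by case: (others (f u)) => ->; have [] := hc x.
Qed.

End TildeA.

(** * Flags along a branch *)

Section Blocks.
Variable R : realType.
Local Notation H := (ell2 R).

Implicit Types Q A : pred nat.

(** The sum of countably many copies of l2, the first index being the number of the
    copy. A diagram only uses the first N copies. *)
Definition blocks := l2 R (predT : pred (nat * nat)).
Local Notation K := blocks.
Implicit Types x : K.

Definition in_block (b : nat) (i : nat * nat) : option nat :=
  if i.1 == b then Some i.2 else None.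

Lemma in_block_inj b i j n : in_block b i = Some n -> in_block b j = Some n -> i = j.
Proof.
case: i j => [i1 i2] [j1 j2]; rewrite /in_block /=.
by do 2!case: eqP => //= ->; move=> [->] [->].
Qed.

Lemma of_block_inj (b i j : nat) n :
  Some (b, i) = Some n -> Some (b, j) = Some n -> i = j.
Proof. by move=> [<-] []. Qed.

Definition block_in (b : nat) : H -> K :=
  wreindex predT (@in_block_inj b) (fun=> sqmod1 R).
Definition block_out (b : nat) : K -> H :=
  wreindex predT (@of_block_inj b) (fun=> sqmod1 R).

Lemma blin_block_in b : bounded_linear (block_in b). Proof. exact: blin_wreindex. Qed.
Lemma blin_block_out b : bounded_linear (block_out b). Proof. exact: blin_wreindex. Qed.

Lemma block_inE b y i : block_in b y i = if i.1 == b then y i.2 else 0.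
Proof.
by rewrite /block_in wreindexE /= /in_block; case: eqP => //= _; rewrite mul1r.
Qed.

Lemma block_outE b x n : block_out b x n = x (b, n).
Proof. by rewrite /block_out wreindexE /= mul1r. Qed.

Lemma block_outK c b y : block_out c (block_in b y) = if c == b then y else 0.
Proof. by apply: l2_ext => n; rewrite block_outE block_inE /=; case: eqP. Qed.

Lemma blocks_ext x y : (forall b, block_out b x = block_out b y) -> x = y.
Proof.
move=> xy; apply: l2_ext => -[b n].
by have := congr1 (fun z : H => z n) (xy b); rewrite !block_outE.
Qed.

Definition cutb (Q : pred nat) : K -> K := cutoff (fun i : nat * nat => Q i.1).

Lemma blin_cutb Q : bounded_linear (cutb Q). Proof. exact: blin_cutoff. Qed.

Lemma block_out_cutb Q c x : block_out c (cutb Q x) = if Q c then block_out c x else 0.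
Proof.
apply: l2_ext => n; rewrite block_outE cutoffE /=.
by case: ifP => //; rewrite block_outE.
Qed.

Lemma cutbI Q A x : cutb Q (cutb A x) = cutb (predI Q A) x.
Proof. by apply: blocks_ext => c; rewrite !block_out_cutb /=; case: (Q c). Qed.

Lemma eq_cutb Q A x : Q =1 A -> cutb Q x = cutb A x.
Proof. by move=> e; apply: blocks_ext => c; rewrite !block_out_cutb e. Qed.

Lemma cutb_sub Q A x : (forall c, Q c -> A c) -> cutb Q (cutb A x) = cutb Q x.
Proof.
by move=> s; rewrite cutbI; apply: eq_cutb => c /=; case E: (Q c) => //=; exact: s.
Qed.

Lemma cutb_sub' Q A x : (forall c, Q c -> A c) -> cutb A (cutb Q x) = cutb Q x.
Proof.
move=> s; rewrite cutbI; apply: eq_cutb => c /=; rewrite andbC.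
by case E: (Q c) => //=; exact: s.
Qed.

Lemma cutb_block_in Q b y : cutb Q (block_in b y) = if Q b then block_in b y else 0.
Proof.
apply: blocks_ext => c; rewrite block_out_cutb; case: ifP => Qc; case: ifP => Qb //.
- by rewrite block_outK; case: eqP Qc => [->|]; rewrite ?Qb // (blin0 (blin_block_out _)).
- by rewrite block_outK; case: eqP Qc => [->|]; rewrite ?Qb.
- by rewrite (blin0 (blin_block_out _)).
Qed.

Lemma cutb_decomp N x :
  cutb (fun c => (c < N)%N) x = \sum_(c < N) block_in c (block_out c x).
Proof.
apply: blocks_ext => c; rewrite block_out_cutb (blin_sum (blin_block_out c)).
case: ltnP => cN.
  rewrite (bigD1 (Ordinal cN)) //= block_outK eqxx big1 ?addr0 // => b bc.
  by rewrite block_outK; case: (c =P b) => // e; case/eqP: bc; apply: val_inj.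
rewrite big1 // => b _; rewrite block_outK.
by case: eqP cN => // ->; rewrite leqNgt ltn_ord.
Qed.

Lemma blocks_blin_ext N (T T' : K -> K) : bounded_linear T -> bounded_linear T' ->
  (forall x, T (cutb (fun c => (c < N)%N) x) = T x) ->
  (forall x, T' (cutb (fun c => (c < N)%N) x) = T' x) ->
  (forall x, cutb (fun c => (c < N)%N) (T x) = T x) ->
  (forall x, cutb (fun c => (c < N)%N) (T' x) = T' x) ->
  (forall c c' y, (c < N)%N -> (c' < N)%N ->
     block_out c' (T (block_in c y)) = block_out c' (T' (block_in c y))) ->
  forall x, T x = T' x.
Proof.
move=> hT hT' Tc T'c cT cT' h x.
rewrite -Tc -T'c cutb_decomp (blin_sum hT) (blin_sum hT'); apply: eq_bigr => c _.
rewrite -cT -cT'; apply: blocks_ext => c'; rewrite !block_out_cutb.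
by case: ifP => // c'N; exact: h.
Qed.

(** A branch of length k seen inside the centre K. The map lev sends a coordinate block
    to its layer in the flag of the branch, T 0 is the endomorphism at the centre, T j
    the one at depth j, and out j tells whether the j-th arrow points away from the
    centre. *)
Section Chain.
Variables (N k : nat) (lev : nat -> nat) (out : nat -> bool) (T : nat -> K -> K).
Hypothesis lev_le : forall c, (c < N)%N -> (lev c <= k)%N.

(** An outward arrow is a projection that forgets the lowest remaining layer, an inward
    arrow an inclusion that misses the highest one. So the layers left at depth j
    form an interval of length k + 1 - j that starts at the number of outward arrows
    met so far. *)
Definition low (j : nat) : nat := \sum_(i < j) out i.+1.

Definition window (j : nat) : pred nat :=
  fun c => (c < N)%N && (low j <= lev c < low j + (k.+1 - j))%N.

Hypothesis T_cut : forall j x, (j <= k)%N -> T j (cutb (window j) x) = T j x.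
Hypothesis cut_T : forall j x, (j <= k)%N -> cutb (window j) (T j x) = T j x.
Hypothesis T_blin : forall j, (j <= k)%N -> bounded_linear (T j).
Hypothesis T_step : forall j x, (j < k)%N ->
  if out j.+1 then T j.+1 (cutb (window j) x) = cutb (window j.+1) (T j x)
  else T j (cutb (window j.+1) x) = cutb (window j) (T j.+1 x).

Lemma lowS j : low j.+1 = (low j + out j.+1)%N.
Proof. by rewrite /low big_ord_recr. Qed.

Lemma window0 c : window 0 c = (c < N)%N.
Proof.
by rewrite /window /low big_ord0 add0n subn0 /=; case: ltnP => // /lev_le; rewrite ltnS.
Qed.

Lemma window_sub j c : (j < k)%N -> window j.+1 c -> window j c.
Proof.
rewrite /window lowS => jk /andP[-> /andP[h1 h2]] /=.
by case: (out _) h1 h2 => /=; lia.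
Qed.

(** When a layer is split off at depth j + 1, the commutation relation of this arrow says
    that T 0 has no entry leading from the layer up to the remaining ones (outward
    arrow), or from the remaining ones up to the layer (inward arrow). These are
    the pairs of layers that cease to lie in a common window. *)
Lemma chain_compression j : (j <= k)%N ->
  (forall x, T j x = cutb (window j) (T 0 (cutb (window j) x))) /\
  (forall c c' y, (c < N)%N -> (c' < N)%N -> (lev c < lev c')%N ->
     ~~ (window j c && window j c') -> block_out c' (T 0 (block_in c y)) = 0).
Proof.
elim: j => [_|j IH jk].
  split=> [x|c c' y cN c'N _]; first by rewrite T_cut // cut_T.
  by rewrite !window0 cN c'N.
have [Tj ent] := IH (ltnW jk).
have sub c : window j.+1 c -> window j c by exact: window_sub.
have entry c c' y : window j c -> window j c' ->
    block_out c' (T j (block_in c y)) = block_out c' (T 0 (block_in c y)).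
  by move=> wc wc'; rewrite Tj block_out_cutb wc' cutb_block_in wc.
have step x := T_step x jk.
have [oj|oj] := boolP (out j.+1).
  have {}step x : T j.+1 (cutb (window j) x) = cutb (window j.+1) (T j x).
    by have := step x; rewrite oj.
  split=> [x|c c' y cN c'N cc' nw].
    rewrite -(T_cut x jk) -(cutb_sub' x sub) step Tj (cutb_sub _ sub).
    by rewrite (cutb_sub' x sub).
  have [/andP[wc wc']|] := boolP (window j c && window j c'); last exact: ent.
  rewrite -entry //.
  have nc : ~~ window j.+1 c.
    move: nw wc wc'; rewrite /window cN c'N /= lowS oj; lia.
  have c'w : window j.+1 c'.
    move: nc wc wc'; rewrite /window cN c'N /= lowS oj; lia.
  have /(congr1 (block_out c')) := step (block_in c y).
  rewrite block_out_cutb c'w => <-.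
  rewrite -(T_cut _ jk) (cutb_sub _ sub) cutb_block_in (negbTE nc).
  by rewrite (blin0 (T_blin jk)) (blin0 (blin_block_out _)).
have {}step x : T j (cutb (window j.+1) x) = cutb (window j) (T j.+1 x).
  by have := step x; rewrite (negbTE oj).
split=> [x|c c' y cN c'N cc' nw].
  rewrite -[X in T 0 X](cutb_sub' x sub) -[RHS](cutb_sub _ sub) -Tj step.
  by rewrite (cutb_sub _ sub) (cut_T _ jk).
have [/andP[wc wc']|] := boolP (window j c && window j c'); last exact: ent.
rewrite -entry //.
have nc : ~~ window j.+1 c'.
  move: nw wc wc'; rewrite /window cN c'N /= lowS (negbTE oj); lia.
have wSc : window j.+1 c.
  move: nc wc wc'; rewrite /window cN c'N /= lowS (negbTE oj); lia.
have := step (block_in c y); rewrite cutb_block_in wSc => ->.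
by rewrite -(cut_T _ jk) (cutb_sub' _ sub) block_out_cutb (negbTE nc).
Qed.

(** At depth k a single layer is left, so that every increasing pair of layers has been
    separated. *)
Lemma chain_triangular c c' y : (c < N)%N -> (c' < N)%N -> (lev c < lev c')%N ->
  block_out c' (T 0 (block_in c y)) = 0.
Proof.
move=> cN c'N cc'; apply: (chain_compression (leqnn k)).2 => //.
by rewrite /window cN c'N /=; lia.
Qed.

End Chain.
End Blocks.

(** * Stars *)

(** A flag is presented as a coordinate flag seen through the shear 1 - M. No target
    block of M is a source block, hence M squares to 0 and 1 + M is the inverse. *)
Section Shear.
Variables (R : realType) (N : nat).
Local Notation H := (ell2 R).
Local Notation K := (blocks R).

Definition matop (M : nat -> nat -> H -> H) (x : K) : K :=
  \sum_(c < N) block_in c (\sum_(b < N) M c b (block_out b x)).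
Definition shear M (x : K) : K := x - matop M x.
Definition unshear M (x : K) : K := x + matop M x.

Definition ltN : pred nat := fun c => (c < N)%N.

Lemma block_out_matop M c x :
  block_out c (matop M x) = if (c < N)%N then \sum_(b < N) M c b (block_out b x) else 0.
Proof.
rewrite /matop (blin_sum (blin_block_out R c)); case: ltnP => cN.
  rewrite (bigD1 (Ordinal cN)) //= block_outK eqxx [X in _ + X]big1 ?addr0 // => b bc.
  by rewrite block_outK; case: (c =P b) => // e; case/eqP: bc; apply: val_inj.
rewrite big1 // => b _; rewrite block_outK.
by case: eqP cN => // ->; rewrite leqNgt ltn_ord.
Qed.

Definition entry (T : K -> K) (c' c : nat) (y : H) : H :=
  block_out c' (T (block_in c y)).

Definition shear_pattern (M : nat -> nat -> H -> H) (tg : pred nat) : Prop :=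
  (forall c b, bounded_linear (M c b)) /\
  (forall c b y, ~~ (tg c && ~~ tg b) -> M c b y = 0).

Section Pattern.
Variables (M : nat -> nat -> H -> H) (tg : pred nat).
Hypothesis hM : shear_pattern M tg.

Lemma blin_matop : bounded_linear (matop M).
Proof.
apply: blin_bigsum => c; apply: (blin_comp (blin_block_in R c)).
apply: blin_bigsum => b; apply: (blin_comp (hM.1 c b)); exact: blin_block_out.
Qed.

Lemma blin_shear : bounded_linear (shear M).
Proof. exact: blin_add (blin_id _) (blin_opp blin_matop). Qed.

Lemma blin_unshear : bounded_linear (unshear M).
Proof. exact: blin_add (blin_id _) blin_matop. Qed.

Lemma matop_matop x : matop M (matop M x) = 0.
Proof.
apply: blocks_ext => c; rewrite block_out_matop (blin0 (blin_block_out _ _)).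
case: ifP => // _.
rewrite big1 // => b _; rewrite block_out_matop ltn_ord.
have [tb|tb] := boolP (tg b); first by rewrite hM.2 // tb andbF.
rewrite big1 ?(blin0 (hM.1 _ _)) // => d _.
by rewrite hM.2 // (negbTE tb).
Qed.

Lemma unshearK : cancel (unshear M) (shear M).
Proof.
by move=> x; rewrite /unshear /shear (blinD blin_matop) matop_matop addr0 addrK.
Qed.

Lemma cutb_matop x : cutb ltN (matop M x) = matop M x.
Proof.
apply: blocks_ext => c; rewrite block_out_cutb block_out_matop /ltN.
by case: (c < N)%N.
Qed.

Lemma matop_cutb x : matop M (cutb ltN x) = matop M x.
Proof.
apply: blocks_ext => c; rewrite !block_out_matop; case: ifP => // _.
by apply: eq_bigr => b _; rewrite block_out_cutb /ltN ltn_ord.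
Qed.

Lemma shear_cutb x : shear M (cutb ltN x) = cutb ltN (shear M x).
Proof. by rewrite /shear matop_cutb (blinB (blin_cutb _ _)) cutb_matop. Qed.

Lemma unshear_cutb x : unshear M (cutb ltN x) = cutb ltN (unshear M x).
Proof. by rewrite /unshear matop_cutb (blinD (blin_cutb _ _)) cutb_matop. Qed.

(** s is the column of T (1 + M) that belongs to the block c. *)
Lemma conj_entry (T : K -> K) c' c y : bounded_linear T -> (c' < N)%N -> (c < N)%N ->
  let s d := entry T d c y + \sum_(b < N) entry T d b (M b c y) in
  entry (shear M \o (T \o unshear M)) c' c y = s c' - \sum_(d < N) M c' d (s d).
Proof.
move=> hT c'N cN /=.
have sE d : block_out d (T (unshear M (block_in c y))) = block_out d (T (block_in c y)) +
    \sum_(b < N) block_out d (T (block_in b (M b c y))).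
  rewrite /unshear (blinD hT) (blinD (blin_block_out _ _)); congr (_ + _).
  rewrite /matop (blin_sum hT) (blin_sum (blin_block_out _ _)); apply: eq_bigr => b _.
  rewrite (bigD1 (Ordinal cN)) //= block_outK eqxx big1 ?addr0 // => e ec.
  rewrite block_outK; case: ((e : nat) =P c) => // e'; last by rewrite (blin0 (hM.1 _ _)).
  by case/eqP: ec; apply: val_inj.
rewrite /entry /= /shear (blinB (blin_block_out _ _)) sE block_out_matop c'N.
congr (_ - _).
by apply: eq_bigr => d _; rewrite sE.
Qed.

End Pattern.

Definition no_mat : nat -> nat -> H -> H := fun _ _ _ => 0.

Lemma no_mat_pattern : shear_pattern no_mat pred0.
Proof. by split=> // c b; exact: blin_zero. Qed.

Lemma matop_no_mat x : matop no_mat x = 0.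
Proof.
by rewrite /matop big1 // => c _; rewrite big1 // (blin0 (blin_block_in _ _)).
Qed.

Lemma shear_no_mat x : shear no_mat x = x.
Proof. by rewrite /shear matop_no_mat subr0. Qed.

Lemma unshear_no_mat x : unshear no_mat x = x.
Proof. by rewrite /unshear matop_no_mat addr0. Qed.

End Shear.

Section StarTree.
Variable R : realType.
Local Notation H := (ell2 R).
Local Notation K := (blocks R).

(** A branch occupies the vertices labelled b_base + 1, ..., b_base + b_len, from the
    centre outwards. *)
Record branch := Branch {
  b_base : nat;
  b_len : nat;
  b_lev : nat -> nat;
  b_mat : nat -> nat -> H -> H;
  b_tgt : pred nat }.

Variables (G : quiver) (lab : qvertex G -> nat) (vtx : nat -> qvertex G).
Hypothesis labK : cancel lab vtx.
Variables (N : nat) (br : nat -> option branch) (par : nat -> nat).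

Definition branch_ok (b : branch) : Prop :=
  [/\ shear_pattern (b_mat b) (b_tgt b),
      forall c, (c < N)%N -> (b_lev b c <= b_len b)%N,
      forall j, (j < b_len b)%N -> br (b_base b + j.+1) = Some b,
      forall j, (0 < j < b_len b)%N -> par (b_base b + j.+1) = (b_base b + j)%N
    & br (par (b_base b).+1) = None].

Hypothesis br_ok : forall l b, br l = Some b ->
  (b_base b < l <= b_base b + b_len b)%N /\ branch_ok b.
Hypothesis br_edge : forall l b, br l = Some b -> exists a,
  (lab (qsrc a) = par l /\ lab (qtgt a) = l) \/
  (lab (qsrc a) = l /\ lab (qtgt a) = par l).

Definition outward (l : nat) : bool :=
  `[< exists a, lab (qsrc a) = par l /\ lab (qtgt a) = l >].

Definition star_mat (l : nat) := if br l is Some b then b_mat b else @no_mat R.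

Definition star_win (l : nat) : pred nat :=
  if br l is Some b then
    window N (b_len b) (b_lev b) (fun i => outward (b_base b + i)) (l - b_base b)
  else ltN N.

(** The same formula serves both directions of an arrow: compressed to the spaces at its
    two ends, the change of coordinates is an inclusion or a projection. Inside a
    branch the two shears cancel. *)
Definition star_map (a : qarrow G) : K -> K :=
  shear N (star_mat (lab (qtgt a))) \o unshear N (star_mat (lab (qsrc a))).

Lemma star_mat_pattern l : exists tg, shear_pattern (star_mat l) tg.
Proof.
rewrite /star_mat; case E: (br l) => [b|]; last by exists pred0; exact: no_mat_pattern.
by have [_ []] := br_ok E; exists (b_tgt b).
Qed.

Lemma star_map_blin a : bounded_linear (star_map a).
Proof.
have [tg h] := star_mat_pattern (lab (qtgt a)).
have [tg' h'] := star_mat_pattern (lab (qsrc a)).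
exact: blin_comp (blin_shear N h) (blin_unshear N h').
Qed.

Section Endomorphism.
Variable T : qvertex G -> K -> K.
Hypothesis T_blin : forall v, bounded_linear (T v).
Hypothesis T_cut : forall v x, T v (cutb (star_win (lab v)) x) = T v x.
Hypothesis cut_T : forall v x, cutb (star_win (lab v)) (T v x) = T v x.
Hypothesis T_comm : forall a x,
  T (qtgt a) (star_map a (cutb (star_win (lab (qsrc a))) x)) =
  cutb (star_win (lab (qtgt a))) (star_map a (T (qsrc a) x)).

Section Branch.
Variables (b : branch) (l0 : nat).
Hypothesis brb : br l0 = Some b.
Let r := vtx (par (b_base b).+1).

(** At the centre the coordinates are changed to those adapted to the branch, as on the
    rest of the branch. *)
Definition branch_chain (j : nat) : K -> K :=
  if j is j'.+1 then T (vtx (b_base b + j'.+1))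
  else shear N (b_mat b) \o (T r \o unshear N (b_mat b)).

Let ok : branch_ok b. Proof. by have [] := br_ok brb. Qed.
Let hM : shear_pattern (b_mat b) (b_tgt b). Proof. by case: ok. Qed.
Let br_in j : (j < b_len b)%N -> br (b_base b + j.+1) = Some b.
Proof. by case: ok => _ _ + _ _; apply. Qed.

Let lab_in j : (j < b_len b)%N -> lab (vtx (b_base b + j.+1)) = (b_base b + j.+1)%N.
Proof. by move=> /br_in/br_edge[a [[_ <-]|[<- _]]]; rewrite labK. Qed.

Let len_gt0 : (0 < b_len b)%N.
Proof.
have [/andP[h1 h2] _] := br_ok brb; rewrite -(ltn_add2l (b_base b)) addn0.
exact: leq_trans h1 h2.
Qed.

Let lab_r : lab r = par (b_base b).+1.
Proof.
have := br_edge (br_in len_gt0); rewrite addn1 /r.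
by move=> [a [] [h1 h2]]; [rewrite -h1|rewrite -h2]; rewrite labK.
Qed.

Let win_r : star_win (lab r) = ltN N.
Proof. by rewrite lab_r /star_win; case: ok => _ _ _ _ ->. Qed.

Let mat_r : star_mat (lab r) = @no_mat R.
Proof. by rewrite lab_r /star_mat; case: ok => _ _ _ _ ->. Qed.

Let win_in j : (j < b_len b)%N -> star_win (b_base b + j.+1) =
  window N (b_len b) (b_lev b) (fun i => outward (b_base b + i)) j.+1.
Proof. by move=> jk; rewrite /star_win br_in // addKn. Qed.

Let mat_in j : (j < b_len b)%N -> star_mat (b_base b + j.+1) = b_mat b.
Proof. by move=> jk; rewrite /star_mat br_in. Qed.

Local Notation W :=
  (window N (b_len b) (b_lev b) (fun i => outward (b_base b + i))).

Let win0 (x : K) : cutb (W 0) x = cutb (ltN N) x.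
Proof. by apply: eq_cutb => c; rewrite window0 //; case: ok. Qed.

Let Tr_cut (x : K) : T r (cutb (ltN N) x) = T r x. Proof. by rewrite -win_r T_cut. Qed.
Let cut_Tr (x : K) : cutb (ltN N) (T r x) = T r x. Proof. by rewrite -win_r cut_T. Qed.

Lemma branch_chain_blin j : (j <= b_len b)%N -> bounded_linear (branch_chain j).
Proof.
case: j => [_|j jk]; last exact: T_blin.
exact: blin_comp (blin_shear N hM) (blin_comp (T_blin r) (blin_unshear N hM)).
Qed.

Lemma branch_chain_cut j (x : K) : (j <= b_len b)%N ->
  branch_chain j (cutb (W j) x) = branch_chain j x.
Proof.
case: j => [_|j jk] /=; first by rewrite win0 unshear_cutb Tr_cut.
by rewrite -win_in // -[in star_win _](lab_in jk) T_cut.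
Qed.

Lemma cut_branch_chain j (x : K) : (j <= b_len b)%N ->
  cutb (W j) (branch_chain j x) = branch_chain j x.
Proof.
case: j => [_|j jk] /=; first by rewrite win0 -shear_cutb cut_Tr.
by rewrite -win_in // -[in star_win _](lab_in jk) cut_T.
Qed.

Lemma branch_chain_step j (x : K) : (j < b_len b)%N ->
  if outward (b_base b + j.+1) then
    branch_chain j.+1 (cutb (W j) x) = cutb (W j.+1) (branch_chain j x)
  else
    branch_chain j (cutb (W j.+1) x) = cutb (W j) (branch_chain j.+1 x).
Proof.
move=> jk; have edge := br_edge (br_in jk).
have tgt a : lab (qtgt a) = (b_base b + j.+1)%N ->
    qtgt a = vtx (b_base b + j.+1) by move=> <-; rewrite labK.
have src a : lab (qsrc a) = (b_base b + j.+1)%N ->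
    qsrc a = vtx (b_base b + j.+1) by move=> <-; rewrite labK.
have comm a := T_comm a; rewrite /star_map in comm.
case: ifPn => [/asboolP[a [sa ta]]|/asboolP no]; last first.
  have [a [sa ta]] : exists a, lab (qsrc a) = (b_base b + j.+1)%N /\
      lab (qtgt a) = par (b_base b + j.+1).
    by case: edge => a [[sa ta]|[sa ta]]; [case: no; exists a|exists a].
  have := comm a x; rewrite sa win_in // mat_in // (src a sa).
  case: j jk {edge tgt src no sa} ta => [|j] jk ta.
    have -> : qtgt a = r by rewrite /r -addn1 -ta labK.
    rewrite win_r mat_r /= !shear_no_mat => /(congr1 (shear N (b_mat b))).
    move=> e; rewrite e win0 shear_cutb (unshearK N hM).
    done.
  have {}ta : lab (qtgt a) = (b_base b + j.+1)%N.
    by rewrite ta; case: ok => _ _ _ -> //; rewrite jk.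
  have jk' := ltnW jk.
  rewrite ta win_in // mat_in // -[qtgt a]labK ta /=.
  by rewrite !(unshearK N hM).
case: j jk {edge src} tgt sa ta => [|j] jk tgt sa ta.
  have sr : qsrc a = r by rewrite /r -addn1 -sa labK.
  have := comm a (unshear N (b_mat b) x).
  rewrite ta win_in // mat_in // (tgt a ta) sr win_r mat_r /= !unshear_no_mat.
  by rewrite shear_cutb (unshearK N hM) win0.
have := comm a x; rewrite ta win_in // mat_in // (tgt a ta).
have {}sa : lab (qsrc a) = (b_base b + j.+1)%N.
  by rewrite sa; case: ok => _ _ _ -> //; rewrite jk.
have jk' := ltnW jk.
rewrite sa win_in // mat_in // -[qsrc a]labK sa /=.
by rewrite !(unshearK N hM).
Qed.

Lemma branch_triangular c c' y :
  (c < N)%N -> (c' < N)%N -> (b_lev b c < b_lev b c')%N ->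
  entry (shear N (b_mat b) \o (T r \o unshear N (b_mat b))) c' c y = 0.
Proof.
have lev_le : forall i, (i < N)%N -> (b_lev b i <= b_len b)%N by case: ok.
exact: (chain_triangular lev_le branch_chain_cut cut_branch_chain
  branch_chain_blin branch_chain_step).
Qed.

Lemma branch_compression v x : br (lab v) = Some b ->
  T v x = cutb (star_win (lab v)) (shear N (b_mat b) (T r
    (unshear N (b_mat b) (cutb (star_win (lab v)) x)))).
Proof.
move=> brv; have [/andP[h1 h2] _] := br_ok brv.
have [j lv] : exists j, lab v = (b_base b + j.+1)%N.
  by exists (lab v - b_base b).-1; lia.
have jk : (j < b_len b)%N by move: h2; rewrite lv; lia.
have lev_le : forall c, (c < N)%N -> (b_lev b c <= b_len b)%N by case: ok.
have [+ _] := chain_compression lev_le branch_chain_cut cut_branch_chain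
  branch_chain_blin branch_chain_step jk.
by rewrite -[v]labK lv lab_in // win_in //; apply.
Qed.

Lemma branch_root : lab r = par (b_base b).+1 /\ br (lab r) = None.
Proof. by split=> //; rewrite lab_r; case: ok. Qed.

End Branch.
End Endomorphism.

Variable r0 : qvertex G.
Hypothesis r0_root : br (lab r0) = None.
Hypothesis root_ind : forall Q : qvertex G -> Prop, Q r0 ->
  (forall a, br (lab (qsrc a)) = None -> br (lab (qtgt a)) = None ->
     Q (qsrc a) <-> Q (qtgt a)) ->
  forall v, br (lab v) = None -> Q v.
Hypothesis N_gt0 : (0 < N)%N.
Hypothesis rigid : forall T : K -> K, bounded_linear T ->
  (forall x, T (cutb (ltN N) x) = T x) -> (forall x, cutb (ltN N) (T x) = T x) ->
  (forall l b c c' y, br l = Some b ->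
     (c < N)%N -> (c' < N)%N -> (b_lev b c < b_lev b c')%N ->
     entry (shear N (b_mat b) \o (T \o unshear N (b_mat b))) c' c y = 0) ->
  exists k : R[i], forall x, T x = k *: cutb (ltN N) x.

(** The vertices outside all the branches are the roots: the centre of a star, or the
    vertices of the path that replaces it. The hypothesis root_ind says that they
    are connected among themselves. *)
Theorem star_transitive :
  exists X : hilbert_rep R G, infinite_dim_rep X /\ transitive_rep X.
Proof.
exists (compressed_rep (fun v (i : nat * nat) => star_win (lab v) i.1) star_map_blin).
have root_win v : br (lab v) = None -> star_win (lab v) = ltN N.
  by rewrite /star_win => ->.
apply: (@compressed_rep_transitive _ _ _ _ _ _ _ r0 (fun n => (0%N, n))); last 2 first.
- by move=> m n [].
- by move=> n; rewrite root_win.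
move=> T Tb T_cut cut_T T_comm.
have T_root v : br (lab v) = None -> forall x, T v x = T r0 x.
  apply: (root_ind (Q := fun v => forall x, T v x = T r0 x)) => // a sa ta.
  suff e : forall x, T (qtgt a) x = T (qsrc a) x.
    by split=> h x; [rewrite e|rewrite -e].
  move=> x; rewrite -[in LHS]T_cut -[RHS]cut_T.
  have := T_comm a x; rewrite /star_map /star_mat ta sa /= !shear_no_mat !unshear_no_mat.
  by rewrite !root_win.
have [||||k hk] := rigid (T := T r0).
- exact: Tb.
- by move=> x; rewrite -(root_win _ r0_root); exact: T_cut.
- by move=> x; rewrite -(root_win _ r0_root); exact: cut_T.
- move=> l b c c' y brb cN c'N cc'.
  rewrite /entry /= -(T_root (vtx (par (b_base b).+1))); last first.
    by have [] := branch_root brb.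
  exact: (branch_triangular Tb T_cut cut_T T_comm brb).
exists k => v x; case brv: (br (lab v)) => [b|]; last first.
  by rewrite T_root // hk -(root_win _ brv).
rewrite (branch_compression Tb T_cut cut_T T_comm brv _ brv).
rewrite T_root; last by have [] := branch_root brv.
have [_ [hM _ _ _ _]] := br_ok brv.
rewrite hk (blinZ (blin_shear N hM)) (blinZ (blin_cutb _ _)) -unshear_cutb.
rewrite (unshearK N hM) -/(cutb (star_win (lab v)) x); congr (_ *: _).
have sub c : star_win (lab v) c -> ltN N c.
  by rewrite /star_win brv /window => /andP[].
by rewrite (cutb_sub _ sub) cutbI; apply: eq_cutb => c /=; rewrite andbb.
Qed.

End StarTree.

Section OneRootStars.
Variable R : realType.
Local Notation H := (ell2 R).
Local Notation K := (blocks R).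

Lemma ugraph_of_edges_labels (G : quiver) n es :
  ugraph_iso (underlying G) (ugraph_of_edges n es) ->
  all (fun e => (e.1 <= n) && (e.2 <= n))%N es ->
  exists (f : qvertex G -> nat) (vtx : nat -> qvertex G),
  [/\ cancel f vtx, forall v, (f v <= n)%N, forall l, (l <= n)%N -> f (vtx l) = l &
   forall p q, (p, q) \in es -> exists a,
     (f (qsrc a) = p /\ f (qtgt a) = q) \/ (f (qsrc a) = q /\ f (qtgt a) = p)].
Proof.
move=> [f [g [[v fK vK] [arr gK arrK] ends]]] /allP es_le.
exists (fun u => nat_of_ord (f u : 'I_n.+1)), (fun l => v (inord l)); split.
- by move=> u; rewrite inord_val fK.
- by move=> u; rewrite -ltnS; exact: ltn_ord.
- by move=> l ln; rewrite vK inordK.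
move=> p q pq; have /andP[/= pn qn] := es_le _ pq.
have k_lt : (index (p, q) es < size es)%N by rewrite index_mem.
exists (arr (Ordinal k_lt)).
have := ends (arr (Ordinal k_lt)); rewrite arrK /= nth_index //= imsetU1 imset_set1.
move=> /esym/set2_eq[] [-> ->]; rewrite !inordK //; [left|right] => //.
Qed.

Section Rigidity.
Variables (N : nat) (T : K -> K).
Hypotheses (T_blin : bounded_linear T) (T_cut : forall x, T (cutb (ltN N) x) = T x)
  (cut_T : forall x, cutb (ltN N) (T x) = T x).

Lemma blin_entry c' c : bounded_linear (entry T c' c).
Proof.
exact: blin_comp (blin_block_out R c') (blin_comp T_blin (blin_block_in R c)).
Qed.

Lemma entry0 c' c : entry T c' c 0 = 0. Proof. exact: blin0 (blin_entry c' c). Qed.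
Lemma entryD c' c x y : entry T c' c (x + y) = entry T c' c x + entry T c' c y.
Proof. exact: blinD (blin_entry c' c) _ _. Qed.

Lemma scalar_of_entries k :
  (forall c c' y, (c < N)%N -> (c' < N)%N ->
     entry T c' c y = if c' == c then k *: y else 0) ->
  forall x, T x = k *: cutb (ltN N) x.
Proof.
move=> h; apply: (blocks_blin_ext (N := N)) => //.
- exact: blin_scale (blin_cutb R _).
- by move=> x; rewrite cutb_sub.
- by move=> x; rewrite (blinZ (blin_cutb _ _)) cutb_sub.
move=> c c' y cN c'N; rewrite -[LHS]/(entry T c' c y) h //.
rewrite cutb_block_in /ltN cN (blinZ (blin_block_out _ _)) block_outK.
by case: eqP => // _; rewrite scaler0.
Qed.

End Rigidity.

Lemma one_root_star (G : quiver) n es (N : nat) (br : nat -> option (branch R))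
    (par : nat -> nat) :
  ugraph_iso (underlying G) (ugraph_of_edges n es) ->
  all (fun e => (e.1 <= n) && (e.2 <= n))%N es ->
  (forall l b, br l = Some b -> (par l, l) \in es) ->
  (forall l b, br l = Some b ->
    (b_base b < l <= b_base b + b_len b)%N /\ branch_ok N br par b) ->
  br 0 = None -> (forall l, (0 < l <= n)%N -> br l <> None) -> (0 < N)%N ->
  (forall T : K -> K, bounded_linear T ->
    (forall x, T (cutb (ltN N) x) = T x) -> (forall x, cutb (ltN N) (T x) = T x) ->
    (forall l b c c' y, br l = Some b ->
      (c < N)%N -> (c' < N)%N -> (b_lev b c < b_lev b c')%N ->
      entry (shear N (b_mat b) \o (T \o unshear N (b_mat b))) c' c y = 0) ->
    exists k, forall x, T x = k *: cutb (ltN N) x) ->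
  exists X : hilbert_rep R G, infinite_dim_rep X /\ transitive_rep X.
Proof.
move=> iso es_le es_par br_ok br0 br_pos N_gt0 rigid.
have [lab [vtx [labK lab_le vtxK edges]]] := ugraph_of_edges_labels iso es_le.
apply: (star_transitive labK br_ok _ (r0 := vtx 0%N) _ _ N_gt0 rigid).
- by move=> l b /es_par/edges.
- by rewrite vtxK.
- move=> Q Q0 _ v lv; have := lab_le v; case E: (lab v) => [|l] ln.
    by rewrite -[v]labK E.
  by case: (br_pos l.+1) => //; rewrite -E.
Qed.

End OneRootStars.

(** * The trees of types E and D *)

Section TildeE6.
Variable R : realType.
Local Notation H := (ell2 R).
Local Notation K := (blocks R).
Local Notation D := (@dilation R).
Local Notation U := (@ushift R).

(** In coordinates (u, v, w) the three flags of l2^3 are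
      {(x, x, 0)} in {w = 0},   {u = v = 0} in {u = 0},
      {(D x, D x + S x, x)} in {v = D w + S w}.
    This matrix adapts the coordinates to the first flag, e6_mat3 to the third. *)
Definition e6_mat1 (c b : nat) : H -> H :=
  match c, b with 1%N, 0%N => idfun | _, _ => fun=> 0 end.
Definition e6_mat3 (c b : nat) : H -> H :=
  match c, b with
  | 0%N, 2%N => D | 1%N, 2%N => fun x => D x + U x | _, _ => fun=> 0
  end.

Lemma e6_pattern1 : shear_pattern e6_mat1 (pred1 1%N).
Proof.
split=> [c b|c b y].
  by move: c b => [|[|c]] [|[|b]] /=; first [exact: blin_id|exact: blin_zero].
by move: c b => [|[|c]] [|[|b]].
Qed.

Lemma e6_pattern3 : shear_pattern e6_mat3 (pred2 0%N 1%N).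
Proof.
have hDU : bounded_linear (fun x : H => D x + U x).
  exact: blin_add (blin_dilation R) (blin_ushift R).
split=> [c b|c b y].
  by move: c b => [|[|c]] [|[|[|b]]] /=;
    first [exact: hDU|exact: blin_dilation|exact: blin_zero].
by move: c b => [|[|c]] [|[|[|b]]].
Qed.

(** The second flag makes T lower triangular and the first one removes nearly all
    the other entries. The plane of the third flag forces the two first diagonal
    entries to agree, and its line says that their common value intertwines with the
    last diagonal entry through both D and S. *)
Lemma e6_rigid (T : K -> K) : bounded_linear T ->
  (forall x, T (cutb (ltN 3) x) = T x) -> (forall x, cutb (ltN 3) (T x) = T x) ->
  (forall c c' y, (c < c' < 3)%N ->
    entry (shear 3 e6_mat1 \o (T \o unshear 3 e6_mat1)) c' c y = 0) ->
  (forall c c' y, (c' < c < 3)%N -> entry T c' c y = 0) ->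
  (forall c c' y, (c < 3)%N -> (c' < 3)%N ->
    (nth 0 [:: 1; 2; 0] c < nth 0 [:: 1; 2; 0] c')%N ->
    entry (shear 3 e6_mat3 \o (T \o unshear 3 e6_mat3)) c' c y = 0) ->
  exists k, forall x, T x = k *: cutb (ltN 3) x.
Proof.
move=> hT Tc cT f1 f2 f3.
have [p1 p3] := (e6_pattern1, e6_pattern3).
have z := (entry0 hT, blin0 (blin_dilation R), blin0 (blin_ushift R), addr0,
  add0r, subr0).
have t01 y : entry T 0%N 1%N y = 0 by exact: f2.
have t02 y : entry T 0%N 2%N y = 0 by exact: f2.
have t12 y : entry T 1%N 2%N y = 0 by exact: f2.
have t21 y : entry T 2%N 1%N y = 0.
  have := f1 1%N 2%N y isT.
  by rewrite (conj_entry p1) // !big_ord_recl !big_ord0 /bump /= !z.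
have t20 y : entry T 2%N 0%N y = 0.
  have := f1 0%N 2%N y isT.
  by rewrite (conj_entry p1) // !big_ord_recl !big_ord0 /bump /= !z t21 !z.
have t10 y : entry T 1%N 0%N y = 0.
  have := f3 0%N 1%N y isT isT isT.
  by rewrite (conj_entry p3) // !big_ord_recl !big_ord0 /bump /= !z t20 !z.
have t11 y : entry T 1%N 1%N y = entry T 0%N 0%N y.
  have := f1 0%N 1%N y isT.
  rewrite (conj_entry p1) // !big_ord_recl !big_ord0 /bump /= !z t10 t01 !z.
  by move/eqP; rewrite subr_eq0 => /eqP.
have hD y : entry T 0%N 0%N (D y) = D (entry T 2%N 2%N y).
  have := f3 2%N 0%N y isT isT isT.
  rewrite (conj_entry p3) // !big_ord_recl !big_ord0 /bump /= !z.
  by rewrite t20 t21 t01 t02 !z => /eqP; rewrite subr_eq0 => /eqP.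
have hDU y : entry T 0%N 0%N (D y + U y) =
    D (entry T 2%N 2%N y) + U (entry T 2%N 2%N y).
  have := f3 2%N 1%N y isT isT isT.
  rewrite (conj_entry p3) // !big_ord_recl !big_ord0 /bump /= !z.
  by rewrite t20 t21 t10 t11 t12 !z => /eqP; rewrite subr_eq0 => /eqP.
have hU y : entry T 0%N 0%N (U y) = U (entry T 2%N 2%N y).
  by apply: (addrI (D (entry T 2 2 y))); rewrite -hDU (entryD hT) hD.
have [k hk] := shift_pair_rigid (blin_entry hT 2 2) (blin_entry hT 0 0) hD hU.
exists k; apply: scalar_of_entries => // c c' y.
case: c => [|[|[|//]]] _; case: c' => [|[|[|//]]] _ /=;
  by rewrite ?t11 ?t10 ?t20 ?t21 ?t01 ?t02 ?t12 ?(hk y).1 ?(hk y).2.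
Qed.

Definition e6_branch1 := Branch 0 2 id e6_mat1 (pred1 1%N).
Definition e6_branch2 := Branch 2 2 (fun c => 2 - c)%N (@no_mat R) pred0.
Definition e6_branch3 := Branch 4 2 (nth 0%N [:: 1; 2; 0]%N) e6_mat3 (pred2 0%N 1%N).

Definition e6_br (l : nat) : option (branch R) :=
  match l with
  | 1 | 2 => Some e6_branch1 | 3 | 4 => Some e6_branch2 | 5 | 6 => Some e6_branch3
  | _ => None
  end%N.
Definition e6_par := nth 0%N [:: 0; 0; 1; 0; 3; 0; 5]%N.

Lemma tildeE6_transitive (G : quiver) : ugraph_iso (underlying G) tildeE6 ->
  exists X : hilbert_rep R G, infinite_dim_rep X /\ transitive_rep X.
Proof.
move=> iso; apply: (one_root_star (N := 3) (br := e6_br) (par := e6_par) iso) => //.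
- by move=> [|[|[|[|[|[|[|l]]]]]]] b.
- have ok1 : branch_ok 3 e6_br e6_par e6_branch1.
    by split=> //; [exact: e6_pattern1|case=> [|[|j]]|case=> [|[|j]]].
  have ok2 : branch_ok 3 e6_br e6_par e6_branch2.
    split=> //; [exact: no_mat_pattern|by move=> c; rewrite leq_subr| |];
      by case=> [|[|j]].
  have ok3 : branch_ok 3 e6_br e6_par e6_branch3.
    by split=> //; [exact: e6_pattern3|case=> [|[|[|c]]]|case=> [|[|j]]|case=> [|[|j]]].
  by move=> [|[|[|[|[|[|[|l]]]]]]] b //= [<-].
- by move=> [|[|[|[|[|[|[|l]]]]]]].
move=> T hT Tc cT h.
apply: e6_rigid => //.
- by move=> c c' y /andP[cc' c'3]; apply: (h 1%N _ c c' y erefl) => //; exact: ltn_trans c'3.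
- move=> c c' y /andP[cc' c3].
  have := h 3%N _ c c' y erefl c3 (ltn_trans cc' c3).
  rewrite /entry /= shear_no_mat unshear_no_mat; apply.
  by move: cc' c3; lia.
- by move=> c c' y c3 c'3 lv; exact: (h 5%N _ c c' y erefl).
Qed.

End TildeE6.

Section TildeE7.
Variable R : realType.
Local Notation H := (ell2 R).
Local Notation K := (blocks R).
Local Notation D := (@dilation R).
Local Notation U := (@ushift R).

(** For an entry that vanishes off nz: the zeros of a concrete matrix are then found by
    evaluating nz. *)
Definition masked_entry (nz : rel nat) (T : K -> K) (c' c : nat) (y : H) : H :=
  if nz c' c then entry T c' c y else 0.

(** The third branch carries the subspace {(x, y, x + y, D x + S y)} of l2^4, a graph over
    the first two blocks; the other two branches carry opposite coordinate flags. *)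
Definition e7_mat (c b : nat) : H -> H :=
  match c, b with
  | 2, 0 | 2, 1 => idfun | 3, 0 => D | 3, 1 => U | _, _ => fun=> 0%R
  end%N.

Lemma e7_pattern : shear_pattern e7_mat (leq 2).
Proof.
split=> [c b|c b y].
  by move: c b => [|[|[|[|c]]]] [|[|b]] /=;
    first [exact: blin_id|exact: blin_dilation|exact: blin_ushift|exact: blin_zero].
by move: c b => [|[|[|[|c]]]] [|[|b]].
Qed.

(** Opposite full flags leave only the diagonal entries; the graph relates them through
    the four entries 1, 1, D, S of its matrix. *)
Lemma e7_rigid (T : K -> K) : bounded_linear T ->
  (forall x, T (cutb (ltN 4) x) = T x) -> (forall x, cutb (ltN 4) (T x) = T x) ->
  (forall c c' y, (c < c' < 4)%N -> entry T c' c y = 0) ->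
  (forall c c' y, (c' < c < 4)%N -> entry T c' c y = 0) ->
  (forall c c' y, (c < 2 <= c')%N -> (c' < 4)%N ->
    entry (shear 4 e7_mat \o (T \o unshear 4 e7_mat)) c' c y = 0) ->
  exists k, forall x, T x = k *: cutb (ltN 4) x.
Proof.
move=> hT Tc cT up low f3.
have z := (entry0 hT, blin0 (blin_dilation R), blin0 (blin_ushift R), addr0,
  add0r, subr0).
have mask c' c y : (c < 4)%N -> (c' < 4)%N ->
    entry T c' c y = masked_entry (fun i j => i == j) T c' c y.
  move=> c4 c'4; rewrite /masked_entry.
  by case: ltngtP => // cc; [apply: low|apply: up]; rewrite cc.
have t20 y : entry T 2%N 2%N y = entry T 0%N 0%N y.
  have := f3 0%N 2%N y isT isT.
  rewrite (conj_entry e7_pattern) // !big_ord_recl !big_ord0 /bump /= !z.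
  rewrite !mask // /masked_entry /= !z.
  by move/eqP; rewrite subr_eq0 => /eqP.
have t21 y : entry T 2%N 2%N y = entry T 1%N 1%N y.
  have := f3 1%N 2%N y isT isT.
  rewrite (conj_entry e7_pattern) // !big_ord_recl !big_ord0 /bump /= !z.
  rewrite !mask // /masked_entry /= !z.
  by move/eqP; rewrite subr_eq0 => /eqP.
have hD y : entry T 3%N 3%N (D y) = D (entry T 0%N 0%N y).
  have := f3 0%N 3%N y isT isT.
  rewrite (conj_entry e7_pattern) // !big_ord_recl !big_ord0 /bump /= !z.
  rewrite !mask // /masked_entry /= !z.
  by move/eqP; rewrite subr_eq0 => /eqP.
have hU y : entry T 3%N 3%N (U y) = U (entry T 0%N 0%N y).
  rewrite -t20 t21; have := f3 1%N 3%N y isT isT.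
  rewrite (conj_entry e7_pattern) // !big_ord_recl !big_ord0 /bump /= !z.
  rewrite !mask // /masked_entry /= !z.
  by move/eqP; rewrite subr_eq0 => /eqP.
have [k hk] := shift_pair_rigid (blin_entry hT 0 0) (blin_entry hT 3 3) hD hU.
exists k; apply: scalar_of_entries => // c c' y c4 c'4.
rewrite mask // /masked_entry; case: eqP => // <-.
by case: c' c'4 => [|[|[|[|//]]]] _; rewrite -?t21 ?t20 ?(hk y).1 ?(hk y).2.
Qed.

Definition e7_branch1 := Branch 0 3 id (@no_mat R) pred0.
Definition e7_branch2 := Branch 3 3 (fun c => 3 - c)%N (@no_mat R) pred0.
Definition e7_branch3 := Branch 6 1 (fun c => (1 < c) : nat)%N e7_mat (leq 2).

Definition e7_br (l : nat) : option (branch R) :=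
  match l with
  | 1 | 2 | 3 => Some e7_branch1 | 4 | 5 | 6 => Some e7_branch2 | 7 => Some e7_branch3
  | _ => None
  end%N.
Definition e7_par := nth 0%N [:: 0; 0; 1; 2; 0; 4; 5; 0]%N.

Lemma tildeE7_transitive (G : quiver) : ugraph_iso (underlying G) tildeE7 ->
  exists X : hilbert_rep R G, infinite_dim_rep X /\ transitive_rep X.
Proof.
move=> iso; apply: (one_root_star (N := 4) (br := e7_br) (par := e7_par) iso) => //.
- by move=> [|[|[|[|[|[|[|[|l]]]]]]]] b.
- have ok1 : branch_ok 4 e7_br e7_par e7_branch1.
    by split=> //; [exact: no_mat_pattern|case=> [|[|[|j]]]|case=> [|[|[|j]]]].
  have ok2 : branch_ok 4 e7_br e7_par e7_branch2.
    split=> //; [exact: no_mat_pattern|by move=> c; rewrite leq_subr| |];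
      by case=> [|[|[|j]]].
  have ok3 : branch_ok 4 e7_br e7_par e7_branch3.
    by split=> //; [exact: e7_pattern|case=> [|[|[|c]]]|case=> [|[|j]]|case=> [|[|j]]].
  by move=> [|[|[|[|[|[|[|[|l]]]]]]]] b //= [<-].
- by move=> [|[|[|[|[|[|[|[|l]]]]]]]].
move=> T hT Tc cT h.
apply: e7_rigid => //.
- move=> c c' y /andP[cc' c'4].
  have := h 1%N _ c c' y erefl (ltn_trans cc' c'4) c'4 cc'.
  by rewrite /entry /= shear_no_mat unshear_no_mat; apply.
- move=> c c' y /andP[cc' c4].
  have := h 4%N _ c c' y erefl c4 (ltn_trans cc' c4).
  rewrite /entry /= shear_no_mat unshear_no_mat; apply.
  by move: cc' c4; lia.
- move=> c c' y cc' c'4; apply: (h 7%N _ c c' y erefl) => //=; lia.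
Qed.

End TildeE7.

Section TildeE8.
Variable R : realType.
Local Notation H := (ell2 R).
Local Notation K := (blocks R).
Local Notation D := (@dilation R).
Local Notation U := (@ushift R).

(** The six blocks form three pairs (a_i, b_i), numbered 2 i and 2 i + 1. The first flag is
    the full coordinate flag and the second one consists of the last pair and of the
    last two pairs. The third branch carries the graph a = A b of
      A = [0, D, S; 1, 0, 1; 1, 1, 0]. *)
Definition e8_mat (c b : nat) : H -> H :=
  match c, b with
  | 0, 3 => D | 0, 5 => U | 2, 1 | 2, 5 | 4, 1 | 4, 3 => idfun | _, _ => fun=> 0%R
  end%N.

Lemma e8_pattern : shear_pattern e8_mat (fun c => ~~ odd c).
Proof.
split=> [c b|c b y].
  by move: c b => [|[|[|[|[|c]]]]] [|[|[|[|[|[|b]]]]]] /=;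
    first [exact: blin_id|exact: blin_dilation|exact: blin_ushift|exact: blin_zero].
by move: c b => [|[|[|[|[|c]]]]] [|[|[|[|[|[|b]]]]]].
Qed.

(** The first two flags leave upper triangular 2 by 2 blocks with diagonals (p_i, q_i). As
    A has zero diagonal, the graph condition kills their off-diagonal entries and
    becomes p_i A_ij = A_ij q_j for i <> j: six relations that form a hexagon of
    intertwiners, D and S being the two that meet in p_0. *)
Lemma e8_rigid (T : K -> K) : bounded_linear T ->
  (forall x, T (cutb (ltN 6) x) = T x) -> (forall x, cutb (ltN 6) (T x) = T x) ->
  (forall c c' y, (c < c' < 6)%N -> entry T c' c y = 0) ->
  (forall c c' y, (c'./2 < c./2)%N -> (c < 6)%N -> entry T c' c y = 0) ->
  (forall c c' y, (c < 6)%N -> (c' < 6)%N -> odd c -> ~~ odd c' ->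
    entry (shear 6 e8_mat \o (T \o unshear 6 e8_mat)) c' c y = 0) ->
  exists k, forall x, T x = k *: cutb (ltN 6) x.
Proof.
move=> hT Tc cT up low f3.
have z := (entry0 hT, blin0 (blin_dilation R), blin0 (blin_ushift R), addr0,
  add0r, subr0).
have mask c' c y : (c < 6)%N -> (c' < 6)%N ->
    entry T c' c y = masked_entry (fun i j => (i <= j) && (j./2 <= i./2))%N T c' c y.
  move=> c6 c'6; rewrite /masked_entry; case: leqP => cc /=; last by rewrite up // cc.
  by case: leqP => // cc2; rewrite low.
have red c' c y : (c < 6)%N -> (c' < 6)%N -> odd c -> ~~ odd c' ->
    entry T c' c y + \sum_(b < 6) entry T c' b (e8_mat b c y) =
    \sum_(d < 6) e8_mat c' d
      (entry T d c y + \sum_(b < 6) entry T d b (e8_mat b c y)).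
  move=> c6 c'6 oc oc'; apply/eqP; rewrite -subr_eq0.
  by rewrite -(conj_entry e8_pattern) //; apply/eqP; exact: f3.
have t01 y : entry T 0%N 1%N y = 0.
  have := red 0%N 1%N y isT isT isT isT.
  rewrite !big_ord_recl !big_ord0 /bump /= !z.
  by rewrite !mask // /masked_entry /= !z.
have t23 y : entry T 2%N 3%N y = 0.
  have := red 2%N 3%N y isT isT isT isT.
  rewrite !big_ord_recl !big_ord0 /bump /= !z.
  by rewrite !mask // /masked_entry /= !z.
have t45 y : entry T 4%N 5%N y = 0.
  have := red 4%N 5%N y isT isT isT isT.
  rewrite !big_ord_recl !big_ord0 /bump /= !z.
  by rewrite !mask // /masked_entry /= !z.
have t22 y : entry T 2%N 2%N y = entry T 1%N 1%N y.
  have := red 2%N 1%N y isT isT isT isT.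
  rewrite !big_ord_recl !big_ord0 /bump /= !z.
  by rewrite !mask // /masked_entry /= !z.
have t44 y : entry T 4%N 4%N y = entry T 1%N 1%N y.
  have := red 4%N 1%N y isT isT isT isT.
  rewrite !big_ord_recl !big_ord0 /bump /= !z.
  by rewrite !mask // /masked_entry /= !z.
have t33 y : entry T 3%N 3%N y = entry T 1%N 1%N y.
  rewrite -t44; have := red 4%N 3%N y isT isT isT isT.
  rewrite !big_ord_recl !big_ord0 /bump /= !z.
  by rewrite !mask // /masked_entry /= !z.
have t55 y : entry T 5%N 5%N y = entry T 1%N 1%N y.
  rewrite -t22; have := red 2%N 5%N y isT isT isT isT.
  rewrite !big_ord_recl !big_ord0 /bump /= !z.
  by rewrite !mask // /masked_entry /= !z.
have hD y : entry T 0%N 0%N (D y) = D (entry T 1%N 1%N y).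
  rewrite -t33; have := red 0%N 3%N y isT isT isT isT.
  rewrite !big_ord_recl !big_ord0 /bump /= !z.
  by rewrite !mask // /masked_entry /= !z.
have hU y : entry T 0%N 0%N (U y) = U (entry T 1%N 1%N y).
  rewrite -t55; have := red 0%N 5%N y isT isT isT isT.
  rewrite !big_ord_recl !big_ord0 /bump /= !z.
  by rewrite !mask // /masked_entry /= !z.
have [k hk] := shift_pair_rigid (blin_entry hT 1 1) (blin_entry hT 0 0) hD hU.
exists k; apply: scalar_of_entries => // c c' y c6 c'6.
have nodup : (c' == c) || (entry T c' c y == 0).
  move: c c' c6 c'6 => [|[|[|[|[|[|//]]]]]] [|[|[|[|[|[|//]]]]]] _ _ //=;
    by rewrite mask // /masked_entry /= ?t01 ?t23 ?t45.
case: eqP nodup => [->|_ /eqP //] _.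
by move: c c6 => [|[|[|[|[|[|//]]]]]] _;
  rewrite ?t22 ?t44 ?t33 ?t55 ?(hk y).1 ?(hk y).2.
Qed.

Definition e8_branch1 := Branch 0 5 id (@no_mat R) pred0.
Definition e8_branch2 := Branch 5 2 (fun c => 2 - c./2)%N (@no_mat R) pred0.
Definition e8_branch3 :=
  Branch 7 1 (fun c => ~~ odd c : nat)%N e8_mat (fun c => ~~ odd c).

Definition e8_br (l : nat) : option (branch R) :=
  match l with
  | 1 | 2 | 3 | 4 | 5 => Some e8_branch1 | 6 | 7 => Some e8_branch2 | 8 => Some e8_branch3
  | _ => None
  end%N.
Definition e8_par := nth 0%N [:: 0; 0; 1; 2; 3; 4; 0; 6; 0]%N.

Lemma tildeE8_transitive (G : quiver) : ugraph_iso (underlying G) tildeE8 ->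
  exists X : hilbert_rep R G, infinite_dim_rep X /\ transitive_rep X.
Proof.
move=> iso; apply: (one_root_star (N := 6) (br := e8_br) (par := e8_par) iso) => //.
- by move=> [|[|[|[|[|[|[|[|[|l]]]]]]]]] b.
- have ok1 : branch_ok 6 e8_br e8_par e8_branch1.
    by split=> //; [exact: no_mat_pattern|case=> [|[|[|[|[|j]]]]]|case=> [|[|[|[|[|j]]]]]].
  have ok2 : branch_ok 6 e8_br e8_par e8_branch2.
    split=> //; [exact: no_mat_pattern|by move=> c; rewrite leq_subr| |];
      by case=> [|[|j]].
  have ok3 : branch_ok 6 e8_br e8_par e8_branch3.
    split=> //; [exact: e8_pattern|by move=> c /=; case: (odd c)| |];
      by case=> [|[|j]].
  by move=> [|[|[|[|[|[|[|[|[|l]]]]]]]]] b //= [<-].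
- by move=> [|[|[|[|[|[|[|[|[|l]]]]]]]]].
move=> T hT Tc cT h.
apply: e8_rigid => //.
- move=> c c' y /andP[cc' c'6].
  have := h 1%N _ c c' y erefl (ltn_trans cc' c'6) c'6 cc'.
  by rewrite /entry /= shear_no_mat unshear_no_mat; apply.
- move=> c c' y cc' c6.
  have c'6 : (c' < 6)%N by lia.
  have := h 6%N _ c c' y erefl c6 c'6.
  rewrite /entry /= shear_no_mat unshear_no_mat; apply.
  by lia.
- move=> c c' y c6 c'6 oc oc'; apply: (h 8%N _ c c' y erefl) => //=.
  by rewrite oc oc'.
Qed.

End TildeE8.

Section TildeD.
Variable R : realType.
Local Notation H := (ell2 R).
Local Notation K := (blocks R).
Local Notation D := (@dilation R).
Local Notation U := (@ushift R).

(** The four leaves carry the two coordinate axes of l2^2 and the graphs {(D x, x)} and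
    {(S x, x)}. *)
Definition d_mat (W : H -> H) (c b : nat) : H -> H :=
  match c, b with 0%N, 1%N => W | _, _ => fun=> 0%R end.

Lemma d_pattern W : bounded_linear W -> shear_pattern (d_mat W) (pred1 0%N).
Proof.
move=> hW; split=> [c b|c b y].
  by move: c b => [|c] [|[|b]] /=; first [exact: hW|exact: blin_zero].
by move: c b => [|c] [|[|b]].
Qed.

Lemma d_rigid (T : K -> K) : bounded_linear T ->
  (forall x, T (cutb (ltN 2) x) = T x) -> (forall x, cutb (ltN 2) (T x) = T x) ->
  (forall y, entry T 1 0 y = 0) -> (forall y, entry T 0 1 y = 0) ->
  (forall y, entry (shear 2 (d_mat D) \o (T \o unshear 2 (d_mat D))) 0 1 y = 0) ->
  (forall y, entry (shear 2 (d_mat U) \o (T \o unshear 2 (d_mat U))) 0 1 y = 0) ->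
  exists k, forall x, T x = k *: cutb (ltN 2) x.
Proof.
move=> hT Tc cT t10 t01 f3 f4.
have z := (entry0 hT, blin0 (blin_dilation R), blin0 (blin_ushift R), addr0,
  add0r, subr0, t10, t01).
have hD y : entry T 0%N 0%N (D y) = D (entry T 1%N 1%N y).
  have := f3 y; rewrite (conj_entry (d_pattern (blin_dilation R))) //.
  rewrite !big_ord_recl !big_ord0 /bump /= !z.
  by move/eqP; rewrite subr_eq0 => /eqP.
have hU y : entry T 0%N 0%N (U y) = U (entry T 1%N 1%N y).
  have := f4 y; rewrite (conj_entry (d_pattern (blin_ushift R))) //.
  rewrite !big_ord_recl !big_ord0 /bump /= !z.
  by move/eqP; rewrite subr_eq0 => /eqP.
have [k hk] := shift_pair_rigid (blin_entry hT 1 1) (blin_entry hT 0 0) hD hU.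
exists k; apply: scalar_of_entries => // c c' y.
by move: c c' => [|[|//]] [|[|//]] _ _ /=; rewrite ?z ?(hk y).1 ?(hk y).2.
Qed.

Definition d_leaf (i : nat) : branch R :=
  match i with
  | 0 => Branch 0 1 id (@no_mat R) pred0
  | 1 => Branch 1 1 (fun c => 1 - c)%N (@no_mat R) pred0
  | 2 => Branch 2 1 (fun c => 1 - c)%N (d_mat D) (pred1 0%N)
  | _ => Branch 3 1 (fun c => 1 - c)%N (d_mat U) (pred1 0%N)
  end%N.

(** Labels are shifted by one, so that the leaves are 1, 2, 3, 4 and the path is
    5, ..., n + 1. *)
Definition d_br (l : nat) : option (branch R) :=
  match l with
  | 1 => Some (d_leaf 0) | 2 => Some (d_leaf 1) | 3 => Some (d_leaf 2)
  | 4 => Some (d_leaf 3) | _ => None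
  end%N.
Definition d_par (n l : nat) : nat :=
  match l with 1 | 2 => 5 | 3 | 4 => n.+1 | _ => 0 end%N.

Lemma tildeD_transitive (G : quiver) n : (4 <= n)%N ->
  ugraph_iso (underlying G) (tildeD n) ->
  exists X : hilbert_rep R G, infinite_dim_rep X /\ transitive_rep X.
Proof.
move=> n4 iso; have [|f [vtx [fK f_le vtxK edges]]] := ugraph_of_edges_labels iso.
  rewrite all_cat; apply/andP; split; last first.
    by rewrite all_map; apply/allP => i; rewrite mem_iota /=; lia.
  by rewrite /=; lia.
pose lab v := (f v).+1.
have labK : cancel lab (fun l => vtx l.-1) by move=> v; rewrite /lab /= fK.
have br_root l : (4 < l)%N -> d_br l = None by case: l => [|[|[|[|[|l]]]]].
have ok i : (i < 4)%N -> branch_ok 2 d_br (d_par n) (d_leaf i).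
  have n1 : d_br n.+1 = None by apply: br_root; rewrite ltnS.
  case: i => [|[|[|[|//]]]] _; split=> //=;
    try exact: no_mat_pattern;
    try (by move=> c c2; lia); try (by case=> [|j]); try (by case=> [|[|j]]).
  - by apply: d_pattern; exact: blin_dilation.
  - by apply: d_pattern; exact: blin_ushift.
apply: (star_transitive labK (N := 2) (br := d_br) (par := d_par n) _ _
  (r0 := vtx 4)) => //.
- move=> [|[|[|[|[|l]]]]] b //= [<-]; split=> //;
    first [exact: (ok 0%N)|exact: (ok 1%N)|exact: (ok 2)|exact: (ok 3)].
- have leaf p q : (p, q) \in [:: (0, 4); (1, 4); (2, n); (3, n)]%N -> exists a,
      (lab (qsrc a) = q.+1 /\ lab (qtgt a) = p.+1) \/
      (lab (qsrc a) = p.+1 /\ lab (qtgt a) = q.+1).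
    move=> pq; have [|a [[sa ta]|[sa ta]]] := edges p q; first by rewrite mem_cat pq.
      by exists a; right; rewrite /lab sa ta.
    by exists a; left; rewrite /lab sa ta.
  by move=> [|[|[|[|[|l]]]]] b //= _; apply: leaf; rewrite !inE !eqxx ?orbT.
- by rewrite /lab vtxK.
- move=> Q Q4 step.
  have path i : (4 + i <= n)%N -> Q (vtx (4 + i)%N).
    elim: i => [|i IH] h; first by rewrite addn0.
    have Qi := IH (ltnW (leq_trans (_ : 4 + i < 4 + i.+1)%N h)).
    have [|a ha] := edges (4 + i)%N (4 + i).+1.
      rewrite mem_cat; apply/orP; right; apply/mapP; exists (4 + i)%N => //.
      by rewrite mem_iota; lia.
    have big u : (4 <= f u)%N -> d_br (lab u) = None by move=> ?; exact: br_root.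
    have sa : (4 <= f (qsrc a))%N by lia.
    have ta : (4 <= f (qtgt a))%N by lia.
    have := step a (big _ sa) (big _ ta).
    rewrite addnS -(fK (qsrc a)) -(fK (qtgt a)).
    by case: ha => -[-> ->] [h1 h2]; auto.
  move=> v; rewrite /lab => rv; rewrite -[v]fK.
  have fv4 : (4 <= f v)%N by move: rv; case: (f v) => [|[|[|[|m]]]].
  by rewrite -(subnKC fv4); apply: path; rewrite subnKC.
move=> T hT Tc cT h; apply: d_rigid => //.
- move=> y; have := h 1%N _ 0%N 1%N y erefl isT isT isT.
  by rewrite /entry /= shear_no_mat unshear_no_mat; apply.
- move=> y; have := h 2%N _ 1%N 0%N y erefl isT isT isT.
  by rewrite /entry /= shear_no_mat unshear_no_mat; apply.
- by move=> y; exact: (h 3%N _ 1%N 0%N y erefl isT isT isT).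
- by move=> y; exact: (h 4%N _ 1%N 0%N y erefl isT isT isT).
Qed.

End TildeD.

(** * Oriented cycles *)

Lemma blin_rank_one (R : realType) (U V : normedModType R[i]) (phi : U -> R[i]^o)
    (b : V) : bounded_linear phi -> bounded_linear (fun z => (phi z : R[i]) *: b).
Proof.
move=> h; split=> [a x y|]; first by rewrite (blinP h) scalerDl scalerA.
have [_ [M hM]] := h; exists (M * complex.Re `|b|) => x.
rewrite normrZ rmorphM /= RRe_real ?normr_real // mulrAC.
exact: ler_wpM2r.
Qed.

Section OrientedCycle.
Variables (R : realType) (G : quiver) (n : nat).
Variables (f : qvertex G -> 'I_n.+1) (g : qarrow G -> 'I_n.+1).
Hypotheses (bf : bijective f) (bg : bijective g).
Hypothesis f_src : forall a, g a = f (qsrc a).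
Hypothesis f_tgt : forall a, ordS (g a) = f (qtgt a).
Variable X : hilbert_rep R G.
Local Notation H v := (rspace X v).
Local Notation fam := (forall v, H v).

Lemma src_inj (a b : qarrow G) : qsrc a = qsrc b -> a = b.
Proof. by move=> e; apply: (bij_inj bg); rewrite !f_src e. Qed.

Lemma tgt_inj (a b : qarrow G) : qtgt a = qtgt b -> a = b.
Proof.
move=> e; apply: (bij_inj bg); apply: (can_inj (@ordSK n.+1)).
by rewrite !f_tgt e.
Qed.

Lemma incoming (v : qvertex G) : exists a, qtgt a = v.
Proof.
have [ginv _ gK] := bg.
exists (ginv (ord_pred (f v))); apply: (bij_inj bf).
by rewrite -f_tgt gK ord_predK.
Qed.

Let inc v : qarrow G := projT1 (cid (incoming v)).
Let incE v : qtgt (inc v) = v := projT2 (cid (incoming v)).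

Definition cycle_shift (x : fam) : fam := fun v =>
  eq_rect _ (fun u => H u) (rmap X (inc v) (x (qsrc (inc v)))) v (incE v).

Lemma cycle_shiftE (x : fam) a : cycle_shift x (qtgt a) = rmap X a (x (qsrc a)).
Proof.
rewrite /cycle_shift; move: (incE (qtgt a)).
have -> : inc (qtgt a) = a by apply: tgt_inj; rewrite incE.
by move=> e; rewrite (eq_axiomK e).
Qed.

Definition single u (z : H u) : fam := @dfwith _ (fun v => H v : Type) (fun v => 0) u z.

Lemma single_same u (z : H u) : single z u = z.
Proof. exact: dfwith_in. Qed.

Lemma single_other u v (z : H u) : u != v -> single z v = 0.
Proof. exact: dfwith_out. Qed.

Lemma cycle_shift_single a (z : H (qsrc a)) :
  cycle_shift (single z) = single (rmap X a z).
Proof.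
apply: functional_extensionality_dep => v.
have [b <-] := incoming v; rewrite cycle_shiftE.
have [<-|ab] := eqVneq a b; first by rewrite !single_same.
rewrite !single_other ?linear0 //; apply: contra_neq ab; last exact: src_inj.
exact: tgt_inj.
Qed.

Definition walk j u w (z : H u) : H w := iter j cycle_shift (single z) w.

Lemma walk_src j w a (z : H (qsrc a)) :
  walk j w (rmap X a z) = walk j.+1 w z.
Proof. by rewrite /walk iterSr cycle_shift_single. Qed.

Lemma walk_tgt j u a (z : H u) :
  walk j.+1 (qtgt a) z = rmap X a (walk j (qsrc a) z).
Proof. by rewrite /walk iterS cycle_shiftE. Qed.

Lemma blin_rmap a : bounded_linear (rmap X a).
Proof. by split; [exact: linearP|exact: rmap_bounded]. Qed.

Lemma blin_walk j u w : bounded_linear (@walk j u w).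
Proof.
elim: j w => [|j IH] w.
  have [<-|uw] := eqVneq u w.
    have -> : @walk 0 u u = idfun by apply/funext => z; exact: single_same.
    exact: blin_id.
  have -> : @walk 0 u w = fun=> 0 by apply/funext => z; exact: single_other.
  exact: blin_zero.
have [a <-] := incoming w.
have -> : @walk j.+1 u (qtgt a) = rmap X a \o @walk j u (qsrc a).
  by apply/funext => z; exact: walk_tgt.
exact: blin_comp (blin_rmap a) (IH _).
Qed.

(** A walk of j arrows from u ends j steps further on the cycle. *)
Lemma walk_grading j u w (z : H u) :
  val (f w) <> ((f u + j) %% n.+1)%N -> walk j w z = 0.
Proof.
rewrite -val_iter_ordS => h.
have {h} : f w <> iter j (@ordS n.+1) (f u) by move=> e; apply: h; rewrite e.
elim: j w => [|j IH] w.
  by move=> h; apply: single_other; apply/eqP => e; apply: h; rewrite e.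
have [a <-] := incoming w; rewrite walk_tgt -f_tgt => h.
rewrite IH ?linear0 // => e; apply: h; by rewrite iterS -e f_src.
Qed.

Hypothesis X_transitive : transitive_rep X.

Lemma endo_scalar (T : forall v, H v -> H v) :
  (forall v, bounded_linear (T v)) ->
  (forall a x, T (qtgt a) (rmap X a x) = rmap X a (T (qsrc a) x)) ->
  exists c : R[i], forall v x, T v x = c *: x.
Proof.
move=> Tb Tc; apply: ((X_transitive.2 (fun v => blin_map (Tb v))).1).
by split=> [v|//]; exact: (Tb v).2.
Qed.

(** By maximality the next power of the shift vanishes if k < n. If k = n it maps each
    space to itself and commutes with the arrows, so that it is a scalar. *)
Lemma longest_walk : exists k, [/\ (k <= n)%N,
   exists u w (z : H u), walk k w z != 0 &
   exists c : R[i], forall u w (z : H u), walk k.+1 w z = c *: walk 0 w z].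
Proof.
pose nz k := (k <= n)%N && `[< exists u w (z : H u), walk k w z != 0 >].
have nz0 : exists k, nz k.
  exists 0; apply/andP; split => //; apply/asboolP.
  have [[v [x x0]] _] := X_transitive.
  by exists v, v, x; rewrite /walk /= single_same.
have nz_le k : nz k -> (k <= n)%N by move=> /andP[].
case: (ex_maxnP nz0 nz_le) => k /andP[kn /asboolP kP] kmax.
exists k; split => //.
have [k_lt|n_le] := ltnP k n.
  exists 0 => u w z; rewrite scale0r; apply/eqP; apply: contraT => h.
  suff : (k.+1 <= k)%N by rewrite ltnn.
  by apply: kmax; rewrite /nz k_lt; apply/asboolP; exists u, w, z.
have -> : k = n by apply/eqP; rewrite eqn_leq kn.
have [c hc] : exists c : R[i], forall v (x : H v), walk n.+1 v x = c *: x.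
  apply: endo_scalar => [v|a x]; first exact: blin_walk.
  by rewrite walk_src walk_tgt.
exists c => u w z; have [<-|uw] := eqVneq u w.
  by rewrite hc /walk /= single_same.
rewrite [walk 0 w z]single_other // scaler0; apply: walk_grading.
rewrite modnDr modn_small // => /val_inj/(bij_inj bf) e.
by rewrite e eqxx in uw.
Qed.

Lemma blin_functional (K : hilbert R) (y : K) :
  bounded_linear (fun z : K => hdot K z y : R[i]^o).
Proof.
split=> [a z z'|]; first by rewrite linearDl linearZl_LR.
exists (complex.Re `|y|) => z; rewrite RRe_real ?normr_real //.
rewrite -ler_sqr ?nnegrE ?mulr_ge0 // exprMn !hdot_norm mulrC.
exact: dot_CauchySchwarz.
Qed.

(** T is the diagonal part of \sum_(j <= k) Sh^(k-j) (x0 (x) phi) Sh^j, where phi is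
    normalized at the end point y0 of a longest walk from x0. Shorter walks from
    v do not reach w, so that T fixes x0. *)
Lemma cyclic_finite_dim : ~ infinite_dim_rep X.
Proof.
have [k [kn [v [w [x0 nz]]] [c hc]]] := longest_walk.
set y0 := walk k w x0 in nz.
pose q := hdot (H w) y0 y0.
pose phi (z : H w) : R[i] := q^-1 * hdot (H w) z y0.
pose T u (z : H u) : H u := \sum_(j < k.+1) phi (walk j w z) *: walk (k - j) u x0.
have phi_lin a (z : H w) : phi (a *: z) = a * phi z.
  by rewrite /phi linearZl_LR mulrCA.
have phi_y0 : phi y0 = 1 by rewrite /phi mulVf // dnorm_eq0.
have phi_blin : bounded_linear (phi : H w -> R[i]^o).
  exact: (blin_scale q^-1 (blin_functional y0)).
have T_blin u : bounded_linear (@T u).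
  apply: blin_bigsum => j.
  exact: (blin_rank_one _ (blin_comp phi_blin (blin_walk j u w))).
have T_comm a z : T (qtgt a) (rmap X a z) = rmap X a (T (qsrc a) z).
  (* Both sides are sums of F over intervals that differ only in F 0 = F k.+1. *)
  pose F (j : nat) := phi (walk j w z) *: walk (k.+1 - j) (qtgt a) x0.
  have -> : T (qtgt a) (rmap X a z) = \sum_(j < k.+1) F j.+1.
    by apply: eq_bigr => j _; rewrite walk_src /F subSS.
  have -> : rmap X a (T (qsrc a) z) = \sum_(j < k.+1) F j.
    rewrite (blin_sum (blin_rmap a)); apply: eq_bigr => j _.
    have jk : (j <= k)%N by rewrite -ltnS.
    by rewrite (blinZ (blin_rmap a)) /F (subSn jk) walk_tgt.
  have FE : F k.+1 = F 0.
    by rewrite /F subnn subn0 !hc phi_lin scalerA mulrC -scalerA.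
  by rewrite big_ord_recr [RHS]big_ord_recl /= FE addrC.
have [d hd] := endo_scalar T_blin T_comm.
have fw : val (f w) = ((f v + k) %% n.+1)%N.
  by apply: contrapT => /walk_grading h; move: nz; rewrite /y0 h eqxx.
have x0_neq0 : x0 != 0.
  by apply: contraNneq nz => x00; rewrite /y0 x00 (blin0 (blin_walk _ _ _)).
have Tx0 : T v x0 = x0.
  rewrite /T big_ord_recr /= big1 ?add0r => [|j _].
    by rewrite -/y0 phi_y0 scale1r subnn /walk /= single_same.
  rewrite (_ : walk j w x0 = 0) ?(blin0 phi_blin) ?scale0r //.
  apply: walk_grading; rewrite fw => /eqP; rewrite eqn_modDl !modn_small.
  - by rewrite gtn_eqF.
  - exact: leq_trans (ltn_ord j) (leqW kn).
  - by rewrite ltnS.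
have d1 : d = 1.
  have := hd v x0; rewrite Tx0 => /eqP; rewrite -subr_eq0 -{1}[x0]scale1r -scalerBl.
  by rewrite scaler_eq0 (negbTE x0_neq0) orbF subr_eq0 => /eqP.
move=> [u]; apply; exists k.+1, (fun j : 'I_k.+1 => walk (k - j) u x0) => z.
by exists (fun j => phi (walk j w z)); rewrite -[LHS]scale1r -d1 -hd.
Qed.

End OrientedCycle.

(** * Existence of infinite-dimensional transitive representations *)

Theorem theorem4p28 (R : realType) (G : quiver)
    (hG : extended_dynkin (underlying G)) :
  (exists X : hilbert_rep R G, infinite_dim_rep X /\ transitive_rep X)
    <-> ~ oriented_cyclic G.
Proof.
split=> [[X [Xinf Xtr]] [n [f [g [bf bg fs ft]]]]|nc].
  exact: (cyclic_finite_dim bf bg fs ft Xtr Xinf).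
case: hG => [[n iso]|[[n n4 iso]|[iso|[iso|iso]]]].
- exact: tildeA_transitive iso nc.
- exact: tildeD_transitive n4 iso.
- exact: tildeE6_transitive iso.
- exact: tildeE7_transitive iso.
- exact: tildeE8_transitive iso.
Qed.
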